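(* For every $n\ge1$, $1\le k\le n$ and $\epsilon>0$, there is a quantum algorithm that $\epsilon$-tests the set $k\text{-Juntas}\subseteq\mathbb{U}_N$ using $O(k\log(k/\epsilon)/\epsilon^2)$ queries to $U$, where the implied constant is independent of $n$, $k$, $\epsilon$.
   Context: Let $n\ge1$, $N=2^n$, $\mathbb{U}_d$ the $d\times d$ unitaries, and $[n]=\{1,\dots,n\}$ indexing the qubits of $(\mathbb{C}^2)^{\otimes n}$. For $T\subseteq[n]$ and $V\in\mathbb{U}_{2^{|T|}}$, $V_T\otimes I_{T^c}$ is the operator acting as $V$ on the qubits in $T$ and as the identity on the others. $k\text{-Juntas}=\{U\in\mathbb{U}_N:\exists T\subseteq[n], |T|=k, \exists V\in\mathbb{U}_{2^k}, U=V_T\otimes I_{T^c}\}$. $\|A\|=\sqrt{\mathrm{tr}(A^\dagger A)}$; $D(A,B)=\min_{\theta\in[0,2\pi)}\frac{1}{\sqrt{2N}}\|e^{i\theta}A-B\|$; $D(A,\mathcal{S})=\inf_{B\in\mathcal{S}}D(A,B)$. For $\mathcal{S}\subseteq\mathbb{U}_N$, $U$ has property $\mathcal{S}$ if $U=e^{i\theta}V$ for some $V\in\mathcal{S}$, real $\theta$; $U$ is $\epsilon$-far from $\mathcal{S}$ if $D(U,V)\ge\epsilon$ for all $V\in\mathcal{S}$. Testing model: the unknown $U\in\mathbb{U}_N$ is a black box; the algorithm may prepare arbitrary states on the system plus an ancilla, apply $U\otimes I$ (one query each), interleaved with arbitrary fixed quantum operations, and measure. It $\epsilon$-tests $\mathcal{S}$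 if for every $U\in\mathbb{U}_N$ it accepts with probability $\ge2/3$ when $U$ has property $\mathcal{S}$ and with probability $\le1/3$ when $U$ is $\epsilon$-far from $\mathcal{S}$.
   Formalization: The query bound is read as O(max(1, k log(k/ε)/ε²)), since the bare expression is zero or negative for ε ≥ k (for example k = 1, ε = 1), where at least one query can be needed. *)

(* Defs.v *)
From Stdlib Require Import Reals Lra Lia List Sorted Arith.
Import ListNotations.
Open Scope R_scope.

Record C := mkC { re : R; im : R }.
Definition C0 : C := mkC 0 0.
Definition C1 : C := mkC 1 0.
Definition Cadd (a b : C) : C := mkC (re a + re b) (im a + im b).
Definition Copp (a : C) : C := mkC (- re a) (- im a).
Definition Csub (a b : C) : C := Cadd a (Copp b).
Definition Cmul (a b : C) : C :=
  mkC (re a * re b - im a * im b) (re a * im b + im a * re b).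
Definition Cconj (a : C) : C := mkC (re a) (- im a).
Definition Cnorm2 (a : C) : R := re a * re a + im a * im a.
Definition Cexpi (t : R) : C := mkC (cos t) (sin t).

Fixpoint Csum (d : nat) (f : nat -> C) : C :=
  match d with O => C0 | S d' => Cadd (Csum d' f) (f d') end.
Fixpoint Rsum (d : nat) (f : nat -> R) : R :=
  match d with O => 0 | S d' => Rsum d' f + f d' end.

Definition Mat := nat -> nat -> C.
Definition Vec := nat -> C.

Definition mmul (d : nat) (A B : Mat) : Mat :=
  fun i j => Csum d (fun l => Cmul (A i l) (B l j)).
Definition mvec (d : nat) (A : Mat) (v : Vec) : Vec :=
  fun i => Csum d (fun l => Cmul (A i l) (v l)).
Definition adj (A : Mat) : Mat := fun i j => Cconj (A j i).
Definition idm : Mat := fun i j => if Nat.eqb i j then C1 else C0.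
Definition mscale (c : C) (A : Mat) : Mat := fun i j => Cmul c (A i j).
Definition msub (A B : Mat) : Mat := fun i j => Csub (A i j) (B i j).

Definition meq (d : nat) (A B : Mat) : Prop :=
  forall i j, (i < d)%nat -> (j < d)%nat -> A i j = B i j.

(* d x d unitary: U^dagger U = I (equivalent to U U^dagger = I in finite dim) *)
Definition unitary (d : nat) (U : Mat) : Prop := meq d (mmul d (adj U) U) idm.

Definition fnorm (d : nat) (A : Mat) : R :=
  sqrt (Rsum d (fun i => Rsum d (fun j => Cnorm2 (A i j)))).

Definition vnorm2 (d : nat) (v : Vec) : R := Rsum d (fun i => Cnorm2 (v i)).

(* D(A,B) = min_{theta in [0,2pi)} ||e^{i theta} A - B|| / sqrt(2N);
   "D(U,V) >= eps" is written out as: for all such theta the quantity is >= eps *)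
Definition dist_ge (N : nat) (A B : Mat) (eps : R) : Prop :=
  forall t, 0 <= t < 2 * PI ->
    eps <= / sqrt (2 * INR N) * fnorm N (msub (mscale (Cexpi t) A) B).

Definition has_property (N : nat) (S : Mat -> Prop) (U : Mat) : Prop :=
  exists V t, S V /\ meq N U (mscale (Cexpi t) V).

Definition eps_far (N : nat) (S : Mat -> Prop) (U : Mat) (eps : R) : Prop :=
  forall V, S V -> dist_ge N U V eps.

(* Qubits are indexed 0..n-1; basis index x in [0,2^n) has qubit q in
   state Nat.testbit x q.  For T = [q_0; ...; q_{k-1}] (increasing), the local
   index of x on T is sum_j testbit x q_j * 2^j. *)
Fixpoint restr (T : list nat) (x : nat) : nat :=
  match T with
  | [] => O
  | q :: T' => ((if Nat.testbit x q then 1 else 0) + 2 * restr T' x)%nat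
  end.

Definition agree_off (n : nat) (T : list nat) (x y : nat) : bool :=
  forallb (fun q => if existsb (Nat.eqb q) T then true
                    else Bool.eqb (Nat.testbit x q) (Nat.testbit y q))
          (seq 0 n).

(* V_T (x) I_{T^c} as a 2^n x 2^n matrix *)
Definition embed (n : nat) (T : list nat) (V : Mat) : Mat :=
  fun x y => if agree_off n T x y then V (restr T x) (restr T y) else C0.

Definition valid_subset (n k : nat) (T : list nat) : Prop :=
  Sorted lt T /\ length T = k /\ Forall (fun q => (q < n)%nat) T.

Definition juntas (n k : nat) (U : Mat) : Prop :=
  exists T V, valid_subset n k T /\ unitary (2 ^ k) V /\
              meq (2 ^ n) U (embed n T V).

(* U (x) I_a on system (dim N) + ancilla (dim a); combined index i = s + N*t *)
Definition tens_id (N : nat) (U : Mat) : Mat :=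
  fun i j => if Nat.eqb (i / N) (j / N) then U (i mod N) (j mod N) else C0.

Record algorithm := mkAlg {
  anc : nat;
  nq : nat;
  init : Vec;
  ops : nat -> Mat;
  acc_proj : Mat
}.

Definition valid_alg (N : nat) (A : algorithm) : Prop :=
  let D := (N * anc A)%nat in
  (1 <= anc A)%nat /\
  vnorm2 D (init A) = 1 /\
  (forall j, (j <= nq A)%nat -> unitary D (ops A j)) /\
  meq D (adj (acc_proj A)) (acc_proj A) /\
  meq D (mmul D (acc_proj A) (acc_proj A)) (acc_proj A).

Fixpoint run_state (N : nat) (A : algorithm) (U : Mat) (j : nat) : Vec :=
  let D := (N * anc A)%nat in
  match j with
  | O => mvec D (ops A 0) (init A)
  | S j' => mvec D (ops A j) (mvec D (tens_id N U) (run_state N A U j'))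
  end.

Definition accept_prob (N : nat) (A : algorithm) (U : Mat) : R :=
  let D := (N * anc A)%nat in
  vnorm2 D (mvec D (acc_proj A) (run_state N A U (nq A))).

Definition eps_tests (N : nat) (S : Mat -> Prop) (eps : R) (A : algorithm) : Prop :=
  forall U, unitary N U ->
    (has_property N S U -> 2 / 3 <= accept_prob N A U) /\
    (eps_far N S U eps -> accept_prob N A U <= 1 / 3).

(* Main.v *)
(* Applying the black box to halves of n EPR pairs and measuring in the Bell basis
   returns the Pauli string x with probability |hat U(x)|^2, where U = sum_x hat U(x) sigma_x.
   The tester draws m such samples and accepts iff the union of their supports has at
   most k elements. If U is a k-junta on T, every sample is supported in T. If U is
   eps-far, then for each T of size k the weight of the strings supported in T is at
   most 1 - eps^2: that weight is ||W||^2 / 2^k for W the normalised partial trace of U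
   over T^c, which is a contraction, so its polar factor V satisfies Re <V, W> >= ||W||^2, and
   Re <V, W> / 2^k = 1 - ||U - V_T (x) I||^2 / 2N <= 1 - eps^2. Hence each sample
   enlarges a union of size <= k with probability at least eps^2, and m = O(k / eps^2)
   samples suffice. *)
From Pilot Require Import Defs.
From Stdlib Require Import Reals ZArith Lra Lia.
From Stdlib Require List Sorted.
From HB Require structures.
From mathcomp Require all_boot all_order all_algebra spectral complex ring lra zify Rstruct.
Open Scope R_scope.

(** No union bound over the sets T is taken, so n does not enter the count: the seen qubits are
    followed one sample at a time, and a potential that starts at 2^k and loses a factor 1 - eps^2/2
    per sample bounds the acceptance probability. The resulting count k/eps^2 has no logarithm; the
    one in the claim only weakens the bound, except when k/eps is near 1, where the maximum with 1
    takes over. The model measures once, at the end, and the black box always acts on the same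
    register. Hence all pairs are prepared in advance, Bell measurements become unitary basis
    changes, and the pairs are rotated cyclically through that register. The final state is a
    product, so the last projector can replay the classical sampling process on basis indices. The
    partial trace may be singular, so its polar factor is built from a singular value decomposition
    whose missing rows are completed orthonormally. *)

(** * Number of samples: real estimates *)

Lemma query_bound (k m : nat) (eps : R) : (1 <= k)%nat -> 0 < eps <= 1 ->
  INR m <= 16 * INR k / eps ^ 2 ->
  INR (S m) <= 68 * Rmax 1 (INR k * ln (INR k / eps) / eps ^ 2).
Proof.
intros k1 [e0 e1] mle.
assert (k1' : 1 <= INR k) by (apply (le_INR 1); exact k1).
assert (e2 : 0 < eps ^ 2) by (apply pow_lt; exact e0).
assert (e2' : eps ^ 2 <= 1) by nra.
set (x := INR k / eps ^ 2).
assert (x1 : 1 <= x).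
{ unfold x; apply Rmult_le_reg_r with (eps ^ 2); [exact e2|].
  unfold Rdiv; rewrite Rmult_assoc, Rinv_l; lra. }
assert (mx : INR (S m) <= 17 * x).
{ rewrite S_INR; replace (16 * INR k / eps ^ 2) with (16 * x) in mle; [lra|].
  unfold x, Rdiv; ring. }
replace (INR k * ln (INR k / eps) / eps ^ 2) with (x * ln (INR k / eps));
  [|unfold x, Rdiv; ring].
(* Once k/eps is at least 2 the logarithm is at least 1/2. Otherwise k = 1 and eps > 1/2, so [x] is
   at most 4, and 17 * 4 = 68 is paid by the 1 inside [Rmax]. *)
destruct (Rle_or_lt 2 (INR k / eps)) as [h|h].
- assert (l : / 2 <= ln (INR k / eps)).
  { apply Rle_trans with (ln 2); [left; exact ln_lt_2|].
    destruct h as [h|<-]; [left; apply ln_increasing; lra|right; reflexivity]. }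
  assert (RM := Rmax_r 1 (x * ln (INR k / eps))).
  nra.
- assert (kE : INR k < 2 * eps).
  { apply Rmult_lt_reg_r with (/ eps); [apply Rinv_0_lt_compat; exact e0|].
    rewrite Rmult_assoc, Rinv_r; lra. }
  assert (k2 : INR k < INR 2) by (simpl; lra).
  apply INR_lt in k2; assert (k = 1%nat) by lia; subst k.
  assert (x4 : x <= 4).
  { unfold x; apply Rmult_le_reg_r with (eps ^ 2); [exact e2|].
    unfold Rdiv; rewrite Rmult_assoc, Rinv_l; simpl in *; nra. }
  assert (RM := Rmax_l 1 (x * ln (INR 1 / eps))).
  lra.
Qed.

(** The constant 16 makes m eps^2/2 at least 8k. Each of the k doublings is then paid by a factor
    exp(-8), at most 1/9 because exp 8 >= 1 + 8, and (2/9)^k <= 1/3. *)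
Lemma error_bound (k m : nat) (eps : R) : (1 <= k)%nat -> 0 < eps <= 1 ->
  16 * INR k / eps ^ 2 <= INR m ->
  2 ^ k * (1 - eps ^ 2 / 2) ^ m <= 1 / 3.
Proof.
intros k1 [e0 e1] mge.
assert (e2 : 0 < eps ^ 2) by (apply pow_lt; exact e0).
assert (e2' : eps ^ 2 <= 1) by nra.
assert (powexp : forall (y : R) (j : nat), exp y ^ j = exp (INR j * y)).
{ intros y j; induction j as [|j IH]; [simpl; rewrite Rmult_0_l, exp_0; reflexivity|].
  rewrite S_INR; simpl; rewrite IH, <- exp_plus; f_equal; ring. }
assert (H : (1 - eps ^ 2 / 2) ^ m <= (/ 9) ^ k).
{ apply Rle_trans with (exp (- (eps ^ 2 / 2)) ^ m).
  { apply pow_incr; split; [lra|].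
    assert (E := exp_ineq1_le (- (eps ^ 2 / 2))); lra. }
  apply Rle_trans with (exp (Ropp 8) ^ k).
  { rewrite !powexp.
    assert (mk : 8 * INR k <= INR m * (eps ^ 2 / 2)).
    { replace (8 * INR k) with (16 * INR k / eps ^ 2 * (eps ^ 2 / 2)) by (field; lra).
      apply Rmult_le_compat_r; [lra|exact mge]. }
    destruct (Rle_lt_or_eq_dec _ _ mk) as [lt|eq].
    - left; apply exp_increasing; lra.
    - right; f_equal; lra. }
  apply pow_incr; split; [left; apply exp_pos|].
  rewrite exp_Ropp; apply Rinv_le_contravar; [lra|].
  assert (E := exp_ineq1_le 8); lra. }
assert (H2 : 0 <= 2 ^ k) by (apply pow_le; lra).
apply Rle_trans with (2 ^ k * (/ 9) ^ k); [nra|].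
rewrite <- Rpow_mult_distr.
destruct k as [|k]; [lia|]; simpl.
assert (H3 : (2 * / 9) ^ k <= 1 ^ k) by (apply pow_incr; lra).
rewrite pow1 in H3; lra.
Qed.

Lemma query_count (k : nat) (eps : R) : (1 <= k)%nat -> 0 < eps ->
  exists m : nat,
    INR (S m) <= 68 * Rmax 1 (INR k * ln (INR k / eps) / eps ^ 2) /\
    (eps <= 1 -> 2 ^ k * (1 - eps ^ 2 / 2) ^ S m <= 1 / 3).
Proof.
intros k1 e0; destruct (Rle_or_lt eps 1) as [e1|e1].
- set (x := 16 * INR k / eps ^ 2).
  assert (x0 : 0 <= x).
  { unfold x, Rdiv; apply Rmult_le_pos.
    - apply Rmult_le_pos; [lra|apply pos_INR].
    - left; apply Rinv_0_lt_compat, pow_lt, e0. }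
  destruct (base_Int_part x) as [le gt].
  assert (Z0 : (0 <= Int_part x)%Z).
  { apply Z.lt_succ_r, lt_IZR; rewrite succ_IZR; lra. }
  assert (mE : INR (Z.to_nat (Int_part x)) = IZR (Int_part x)).
  { rewrite INR_IZR_INZ, Z2Nat.id; [reflexivity|exact Z0]. }
  (* With m the floor of [x], the query bound uses m <= x and the error bound uses x < m + 1. *)
  exists (Z.to_nat (Int_part x)); split.
  + apply query_bound; [exact k1|lra|rewrite mE; exact le].
  + intros _; apply error_bound; [exact k1|lra|].
    rewrite S_INR, mE; fold x; lra.
(* For eps > 1 the error clause is vacuous, and a single query fits under 68 * 1. *)
- exists 0%nat; split; [|lra].
  assert (RM := Rmax_l 1 (INR k * ln (INR k / eps) / eps ^ 2)); simpl INR; lra.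
Qed.

Module JuntaTester.
Import HB.structures.
Import all_boot all_order all_algebra spectral complex ring lra zify Rstruct.
Import Pilot.Defs.
Set Implicit Arguments. Unset Strict Implicit. Unset Printing Implicit Defensive.
Import Order.TTheory GRing.Theory Num.Theory.
Local Open Scope ring_scope. Local Open Scope sesquilinear_scope.
Delimit Scope R_scope with coqR.

(** * Polar decomposition of a contraction *)

Lemma row_diag_mul (K : comNzRingType) m n (d : 'rV[K]_m) (A : 'M[K]_(m, n)) i :
  row i (diag_mx d *m A) = d 0 i *: row i A.
Proof. by apply/rowP => j; rewrite mul_diag_mx !mxE. Qed.

(** Gram-Schmidt applied to a basis of the kernel of [V^t*]. That kernel has dimension at least n -
    r whatever the rank of [V]; surplus rows are dropped. *)
Lemma orthonormal_complement (K : numClosedFieldType) r n (V : 'M[K]_(r, n)) :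
  exists F : 'M[K]_(n - r, n), F \is unitarymx /\ F *m V^t* = 0.
Proof.
pose B := row_base (kermx (V^t*)).
have rB : (n - r <= \rank (kermx (V^t*)))%N.
  by rewrite mxrank_ker leq_sub2l// rank_leq_col.
have sB : (\rank (kermx (V^t*)) <= n)%N by rewrite rank_leq_row.
pose G := schmidt B.
have GV : G *m V^t* = 0.
  apply/sub_kermxP; rewrite (eqmx_schmidt_free (row_base_free _)).
  by rewrite eq_row_base.
have /row_unitarymxP GU : G \is unitarymx by exact: schmidt_unitarymx.
exists (rowsub (widen_ord rB) G); split.
  apply/row_unitarymxP => i j.
  rewrite !row_rowsub GU.
  by congr (nat_of_bool _)%:R; apply/eqP/eqP => [/(congr1 val) /= /val_inj|->].
by rewrite mul_rowsub_mx GV; apply/matrixP => i j; rewrite !mxE.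
Qed.

(** The hypothesis says that the rows of [Y] are orthogonal with squared norms [d 0 i], so the
    nonzero rows need only be normalised. Zero rows, which occur when [Z] below is singular, leave a
    free choice in [Q]. *)
Lemma unitary_completion (K : numClosedFieldType) n (Y : 'M[K]_n) (d : 'rV[K]_n) :
  Y *m Y^t* = diag_mx d ->
  exists2 Q : 'M[K]_n, Q \is unitarymx & Y = diag_mx (map_mx sqrtC d) *m Q.
Proof.
move=> YY.
have YYE i j : (row i Y *m (row j Y)^t*) 0 0 = d 0 i *+ (i == j).
  have /matrixP/(_ i j) := YY; rewrite !mxE => <-.
  by apply: eq_bigr => l _; rewrite !mxE.
have d0 i : 0 <= d 0 i.
  have := YYE i i; rewrite eqxx mulr1n => <-.
  by rewrite mxE; apply: sumr_ge0 => l _; rewrite !mxE mul_conjC_ge0.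
pose I := [set i | d 0 i != 0].
pose y i := (sqrtC (d 0 i))^-1 *: row i Y.
have [F [FU FV]] := orthonormal_complement (\matrix_(i < #|I|) y (enum_val i)).
have cI : #|~: I| = (n - #|I|)%N by rewrite cardsCs setCK card_ord.
(* The rows where [d] vanishes are filled with an orthonormal family orthogonal to the others. *)
pose q i : 'rV[K]_n := match insub i : option {i | i \in ~: I} with
  | Some z => row (cast_ord cI (enum_rank_in (valP z) i)) F
  | None => y i end.
have qI i : i \in I -> q i = y i.
  by move=> iI; rewrite /q insubF// inE iI.
have qC i (iI : i \in ~: I) : q i = row (cast_ord cI (enum_rank_in iI i)) F.
  rewrite /q; case: insubP => [z zI zi|]; last by rewrite iI.
  congr (row (cast_ord _ _) F); apply: enum_val_inj.
  by rewrite !enum_rankK_in// ?zi.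
have dS i : i \in I -> sqrtC (d 0 i) != 0 by rewrite inE sqrtC_eq0.
have yy i j : i \in I -> j \in I -> (y i *m (y j)^t*) 0 0 = (i == j)%:R.
  move=> iI jI; rewrite /y linearZ /= map_mxZ -scalemxAl -scalemxAr.
  rewrite mxE mxE YYE; case: eqVneq => [->|_]; last by rewrite mulr0n !mulr0.
  rewrite mulr1n -[d 0 j in X in _ * (_ * X)]sqrtCK.
  rewrite /= geC0_conj ?invr_ge0 ?sqrtC_ge0//.
  by rewrite expr2 mulKf ?mulVf// dS.
have fy i j : i \in ~: I -> j \in I -> (q i *m (q j)^t*) 0 0 = 0.
  move=> iI jI; rewrite (qC _ iI) (qI _ jI).
  set r := cast_ord _ _.
  have /matrixP/(_ r (enum_rank_in jI j)) := FV; rewrite [LHS]mxE [RHS]mxE.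
  apply: etrans; rewrite mxE.
  by apply: eq_bigr => l _; rewrite !mxE enum_rankK_in.
exists (\matrix_i q i).
  apply/row_unitarymxP => i j; rewrite dotmxE !rowK.
  have [iI|iI] := boolP (i \in I); have [jI|jI] := boolP (j \in I).
  - by rewrite !qI// yy.
  - have -> : (i == j) = false by apply: contraNF jI => /eqP <-.
    have jI' : j \in ~: I by rewrite inE.
    rewrite -[LHS]conjCK -[RHS]conjCK; congr Num.conj; rewrite conjC_nat mulr0n.
    rewrite -(fy _ _ jI' iI) !mxE rmorph_sum; apply: eq_bigr => l _.
    by rewrite !mxE rmorphM /= conjCK mulrC.
  - have -> : (i == j) = false by apply: contraNF iI => /eqP ->.
    by rewrite fy// inE.
  - have iC : i \in ~: I by rewrite inE.
    have jC : j \in ~: I by rewrite inE.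
    rewrite (qC _ iC) (qC _ jC) -dotmxE.
    have /row_unitarymxP -> := FU.
    congr (nat_of_bool _)%:R.
    apply/eqP/eqP => [/cast_ord_inj/(congr1 enum_val)|ij].
      by rewrite !enum_rankK_in.
    congr (cast_ord _ _); apply: enum_val_inj.
    by rewrite !enum_rankK_in// ij.
apply/row_matrixP => i; rewrite row_diag_mul rowK mxE.
have [iI|iI] := boolP (i \in I).
  by rewrite qI// /y scalerA divff ?scale1r// dS.
have di : d 0 i = 0 by move: iI; rewrite inE negbK => /eqP.
rewrite di sqrtC0 scale0r; apply/eqP.
by rewrite -(dnorm_eq0 (@dotmx K n)) /= dotmxE YYE di mul0rn.
Qed.

(** The hypothesis encodes operator norm at most [b] by a bilinear form, the shape in which a
    partial trace is easily bounded. The spectral theorem for [Z *m Z^t*] yields a singular value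
    decomposition with left factor [P^t*] and right factor [Q]. For the product of these two as [V],
    the traces are the sums of s_i^2 and of s_i, and it remains to see s_i <= b. *)
Lemma polar_lower_bound (K : numClosedFieldType) n (Z : 'M[K]_n) (b : K) :
  (forall a c : 'rV[K]_n, 'Re ((a *m Z *m c^t*) 0 0) *+ 2 <=
     b * ((a *m a^t*) 0 0 + (c *m c^t*) 0 0)) ->
  exists2 V : 'M[K]_n, V \is unitarymx &
    \tr (Z *m Z^t*) <= b * 'Re (\tr (Z *m V^t*)).
Proof.
move=> Zb.
have AN : Z *m Z^t* \is normalmx.
  apply/normalmxP; congr (_ *m _); rewrite !(trmx_mul, map_mxM) /=;
  by rewrite trmxCK.
have /orthomx_spectralP := AN.
set P := spectralmx _; set d := spectral_diag _.
have PU : P \is unitarymx by exact: spectral_unitarymx.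
have /unitarymxP PP := PU.
rewrite invmx_unitary// => ZZ.
have [|Q QU YQ] := @unitary_completion K n (P *m Z) d.
  rewrite trmx_mul map_mxM mulmxA -(mulmxA P) ZZ !mulmxA.
  by rewrite PP mul1mx -mulmxA PP mulmx1.
have ZE : Z = P^t* *m diag_mx (map_mx sqrtC d) *m Q.
  by rewrite -mulmxA -YQ mulmxA -invmx_unitary// mulVmx ?mul1mx// spectral_unit.
have /unitarymxP QQ1 := QU.
set s := map_mx sqrtC d in ZE YQ.
exists (P^t* *m Q); first by rewrite mul_unitarymx// trmxC_unitary.
have -> : \tr (Z *m (P^t* *m Q)^t*) = \sum_i s 0 i.
  rewrite trmx_mul map_mxM trmxCK mulmxA [X in X *m _ *m _]ZE.
  rewrite -[X in X *m P]mulmxA QQ1 mulmx1 mxtrace_mulC.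
  by rewrite mulmxA PP mul1mx mxtrace_diag.
have -> : \tr (Z *m Z^t*) = \sum_i s 0 i * s 0 i.
  rewrite ZZ -mulmxA mxtrace_mulC -mulmxA PP mulmx1 mxtrace_diag.
  by apply: eq_bigr => i _; rewrite mxE -expr2 sqrtCK.
have s0 i : 0 <= s 0 i.
  rewrite mxE sqrtC_ge0.
  have : (P *m Z *m (P *m Z)^t*) i i = d 0 i.
    rewrite trmx_mul map_mxM mulmxA -(mulmxA P) ZZ !mulmxA.
    rewrite PP mul1mx -mulmxA PP mulmx1.
    by rewrite mxE eqxx mulr1n.
  move=> <-; rewrite mxE; apply: sumr_ge0 => l _; rewrite !mxE.
  exact: mul_conjC_ge0.
rewrite raddf_sum mulr_sumr; apply: ler_sum => i _ /=.
have sr : 'Re (s 0 i) = s 0 i by apply/Creal_ReP; rewrite ger0_real.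
rewrite sr ler_wpM2r//.
(* At a pair of singular vectors the hypothesis reads 2 s_i <= 2 b. *)
have := Zb (row i P) (row i Q).
have /row_unitarymxP/(_ i i) := PU; rewrite dotmxE eqxx => ->.
have /row_unitarymxP/(_ i i) := QU; rewrite dotmxE eqxx => QQ; rewrite QQ.
have -> : row i P *m Z = s 0 i *: row i Q.
  by rewrite -row_mul YQ row_diag_mul.
rewrite -scalemxAl mxE QQ mulr1 sr mulrDr mulr1 mulr2n.
by rewrite -!mulr2n ler_pMn2r.
Qed.

(** * The complex numbers as a ring *)

Definition C_pair (z : C) : R * R := (re z, im z).
Definition pair_C (p : R * R) : C := mkC p.1 p.2.

Lemma C_pairK : cancel C_pair pair_C. Proof. by case. Qed.

HB.instance Definition _ := Choice.copy C (can_type C_pairK).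

Lemma C_eq (a b : C) : re a = re b -> im a = im b -> a = b.
Proof. by case: a b => [x y] [u v] /= -> ->. Qed.

Lemma CaddA : associative Cadd.
Proof. by move=> a b c; apply: C_eq => /=; rewrite Rplus_assoc. Qed.
Lemma CaddC : commutative Cadd.
Proof. by move=> a b; apply: C_eq => /=; rewrite Rplus_comm. Qed.
Lemma Cadd0 : left_id C0 Cadd.
Proof. by move=> a; apply: C_eq => /=; rewrite Rplus_0_l. Qed.
Lemma CaddN : left_inverse C0 Copp Cadd.
Proof. by move=> a; apply: C_eq => /=; rewrite Rplus_opp_l. Qed.

HB.instance Definition _ := GRing.isZmodule.Build C CaddA CaddC Cadd0 CaddN.

Lemma CmulA : associative Cmul.
Proof.
by move=> a b c; apply: C_eq; rewrite /= ?(RplusE, RminusE, RmultE, R0E, R1E); ring.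
Qed.
Lemma CmulC : commutative Cmul.
Proof. by move=> a b; apply: C_eq; rewrite /= ?(RplusE, RminusE, RmultE, R0E, R1E); ring. Qed.
Lemma Cmul1 : left_id C1 Cmul.
Proof. by move=> a; apply: C_eq; rewrite /= ?(RplusE, RminusE, RmultE, R0E, R1E); ring. Qed.
Lemma CmulDl : left_distributive Cmul Cadd.
Proof.
by move=> a b c; apply: C_eq; rewrite /= ?(RplusE, RminusE, RmultE, R0E, R1E); ring.
Qed.
Lemma C1_neq0 : C1 != C0.
Proof. by apply/eqP => /(congr1 re) /= /eqP; rewrite oner_eq0. Qed.

HB.instance Definition _ :=
  GRing.Zmodule_isComNzRing.Build C CmulA CmulC Cmul1 CmulDl C1_neq0.

Lemma Csum_big d (f : nat -> C) : Csum d f = \sum_(i < d) f i.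
Proof. by elim: d => [|d IH]; rewrite ?big_ord0// big_ord_recr /= -IH. Qed.

Lemma Rsum_big d (f : nat -> R) : Rsum d f = \sum_(i < d) f i.
Proof. by elim: d => [|d IH]; rewrite ?big_ord0// big_ord_recr /= -IH. Qed.

Lemma re_additive : additive re. Proof. by []. Qed.
HB.instance Definition _ := GRing.isAdditive.Build C R re re_additive.

Lemma Cconj_additive : additive Cconj.
Proof.
move=> a b; apply: C_eq; rewrite //= ?(RplusE, RoppE).
by rewrite opprD.
Qed.
HB.instance Definition _ := GRing.isAdditive.Build C C Cconj Cconj_additive.

Lemma Cconj_multiplicative : multiplicative Cconj.
Proof.
split; last by apply: C_eq => //=; rewrite RoppE oppr0.
by move=> a b; apply: C_eq; rewrite /= ?(RplusE, RoppE, RminusE, RmultE, R0E, R1E); ring.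
Qed.
HB.instance Definition _ := GRing.isMultiplicative.Build C C Cconj Cconj_multiplicative.

(** Identities between real sums of squared moduli are lifted along this injective morphism and
    proved in [C], where a squared modulus is [z * Cconj z]. *)
Definition Rc (x : R) : C := mkC x 0%R.

Lemma Rc_additive : additive Rc.
Proof. by move=> x y; apply: C_eq; rewrite //= RplusE RoppE subr0. Qed.
HB.instance Definition _ := GRing.isAdditive.Build R C Rc Rc_additive.

Lemma Rc_multiplicative : multiplicative Rc.
Proof.
by split=> [x y|//]; apply: C_eq; rewrite /= ?(RplusE, RminusE, RmultE, R0E, R1E); ring.
Qed.
HB.instance Definition _ := GRing.isMultiplicative.Build R C Rc Rc_multiplicative.

Lemma CconjK : involutive Cconj.
Proof. by move=> a; apply: C_eq; rewrite //= RoppE opprK. Qed.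

Lemma Cconj_Rc x : Cconj (Rc x) = Rc x.
Proof. by apply: C_eq; rewrite //= RoppE oppr0. Qed.

Lemma Rc_Cnorm2 z : Rc (Cnorm2 z) = z * Cconj z.
Proof. by apply: C_eq; rewrite /= /Cnorm2 ?(RplusE, RoppE, RminusE, RmultE, R0E, R1E); ring. Qed.

Lemma Cnorm2_re z : Cnorm2 z = re (z * Cconj z).
Proof. by rewrite -Rc_Cnorm2. Qed.

Lemma Rc_inj : injective Rc. Proof. by move=> x y []. Qed.

Lemma Cnorm2M a b : Cnorm2 (a * b) = Cnorm2 a * Cnorm2 b.
Proof. by rewrite /Cnorm2 /= ?(RplusE, RminusE, RmultE, R0E, R1E); ring. Qed.

Lemma Cnorm2_ge0 z : 0 <= Cnorm2 z.
Proof. by rewrite /Cnorm2 !(RplusE, RmultE) -!expr2 addr_ge0 ?sqr_ge0. Qed.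

Lemma Cnorm2_Rc x : Cnorm2 (Rc x) = x ^+ 2.
Proof. by rewrite /Cnorm2 /= !(RplusE, RmultE) mul0r addr0. Qed.

Lemma Cnorm2_0 : Cnorm2 0 = 0. Proof. by rewrite -[0]/(Rc 0) Cnorm2_Rc expr0n. Qed.

Lemma Cnorm2_1 : Cnorm2 1 = 1. Proof. by rewrite -[1]/(Rc 1) Cnorm2_Rc expr1n. Qed.

(** The spectral argument takes place over the closed field [R[i]]; its conclusion is carried back
    to [C] through this isomorphism. *)
Definition C_K (z : C) : R[i] := Complex (re z) (im z).
Definition K_C (z : R[i]) : C := mkC (complex.Re z) (complex.Im z).

Lemma C_K_K z : C_K (K_C z) = z. Proof. by case: z. Qed.

Lemma C_K_additive : additive C_K. Proof. by []. Qed.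
HB.instance Definition _ := GRing.isAdditive.Build C R[i] C_K C_K_additive.
Lemma C_K_multiplicative : multiplicative C_K. Proof. by []. Qed.
HB.instance Definition _ := GRing.isMultiplicative.Build C R[i] C_K C_K_multiplicative.
Lemma C_K_conj z : (C_K z)^* = C_K (Cconj z). Proof. by []. Qed.
Lemma C_K_inj : injective C_K. Proof. by case=> a b [c d] [-> ->]. Qed.
Lemma C_K_Re z : 'Re (C_K z) = C_K (Rc (re z)).
Proof.
rewrite ReE C_K_conj -rmorphD /=; apply: (mulfI (x := 2)); first by rewrite pnatr_eq0.
rewrite mulrC divfK ?pnatr_eq0// mulr_natl -rmorphMn; congr C_K.
by apply: C_eq; rewrite mulr2n //= !(RplusE, RoppE) subrr addr0.
Qed.
Lemma C_K_le x y : (C_K (Rc x) <= C_K (Rc y)) = (x <= y).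
Proof. exact: lecR. Qed.

Lemma big_enum_val_T (K : nmodType) (A : finType) (F : A -> K) :
  \sum_u F u = \sum_(i < #|A|) F (enum_val i).
Proof. exact: (reindex _ (onW_bij _ (@enum_val_bij A))). Qed.

Lemma polar_lower_bound_C (A : finType) (Z : A -> A -> C) (b : R) :
  (forall f g : A -> C, re (\sum_u \sum_v f u * Z u v * Cconj (g v)) *+ 2 <=
     b * (\sum_u Cnorm2 (f u) + \sum_v Cnorm2 (g v))) ->
  exists V : A -> A -> C,
   (forall v w, \sum_u Cconj (V u v) * V u w = (v == w)%:R) /\
   \sum_u \sum_v Cnorm2 (Z u v) <= b * re (\sum_u \sum_v Cconj (V u v) * Z u v).
Proof.
move=> Zb; pose M : 'M[R[i]]_#|A| := \matrix_(i, j) C_K (Z (enum_val i) (enum_val j)).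
have normE (a : 'rV[R[i]]_#|A|) : (a *m a^t*) 0 0 =
    C_K (Rc (\sum_u Cnorm2 (K_C (a 0 (enum_rank u))))).
  rewrite mxE (@big_enum_val_T _ A) !rmorph_sum /=; apply: eq_bigr => i _.
  by rewrite !mxE enum_valK Rc_Cnorm2 rmorphM /= -C_K_conj C_K_K.
have [|V VU] := @polar_lower_bound _ _ M (C_K (Rc b)).
  move=> a c; rewrite !normE.
  have -> : (a *m M *m c ^t*) 0 0 = C_K (\sum_u \sum_v
      K_C (a 0 (enum_rank u)) * Z u v * Cconj (K_C (c 0 (enum_rank v)))).
    rewrite exchange_big /= (@big_enum_val_T _ A) rmorph_sum mxE; apply: eq_bigr => j _.
    rewrite (@big_enum_val_T _ A) rmorph_sum mxE mulr_suml; apply: eq_bigr => i _.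
    by rewrite !mxE !enum_valK !rmorphM /= -C_K_conj !C_K_K.
  rewrite C_K_Re -!(rmorphD, rmorphM, rmorphMn) /= C_K_le.
  exact: Zb.
have -> : \tr (M *m M^t*) = C_K (Rc (\sum_u \sum_v Cnorm2 (Z u v))).
  rewrite (@big_enum_val_T _ A) !rmorph_sum; apply: eq_bigr => i _.
  rewrite mxE (@big_enum_val_T _ A) !rmorph_sum; apply: eq_bigr => j _.
  by rewrite !mxE /= C_K_conj -rmorphM Rc_Cnorm2.
have -> : \tr (M *m V^t*) = C_K (\sum_u \sum_v
    Cconj (K_C (V (enum_rank u) (enum_rank v))) * Z u v).
  rewrite (@big_enum_val_T _ A) rmorph_sum; apply: eq_bigr => i _.
  rewrite mxE (@big_enum_val_T _ A) rmorph_sum; apply: eq_bigr => j _.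
  by rewrite !mxE !enum_valK rmorphM /= -C_K_conj C_K_K mulrC.
rewrite C_K_Re -!rmorphM C_K_le => H.
exists (fun u v => K_C (V (enum_rank u) (enum_rank v))); split=> // v w.
apply: C_K_inj; rewrite rmorph_sum.
have : V^t* *m V = 1%:M by rewrite -(invmx_unitary VU) mulVmx// unitarymx_unit.
move/matrixP/(_ (enum_rank v) (enum_rank w)); rewrite [LHS]mxE [RHS]mxE.
rewrite (inj_eq enum_rank_inj) rmorph_nat => <-.
rewrite (@big_enum_val_T _ A); apply: eq_bigr => i _.
by rewrite !mxE rmorphM /= -C_K_conj !C_K_K enum_valK.
Qed.

(** * The nearest junta *)

Definition isometry_on (X : finType) (U : X -> X -> C) :=
  forall y z, \sum_x Cconj (U x y) * U x z = (y == z)%:R.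

Lemma isometry_norm (X : finType) (U : X -> X -> C) (h : X -> C) :
  isometry_on U -> \sum_x Cnorm2 (\sum_y U x y * h y) = \sum_y Cnorm2 (h y).
Proof.
move=> UU; apply: Rc_inj; rewrite !rmorph_sum /=.
transitivity (\sum_x \sum_y \sum_z U x y * h y * Cconj (U x z * h z)).
  apply: eq_bigr => x _; rewrite Rc_Cnorm2 rmorph_sum /= mulr_suml.
  by apply: eq_bigr => y _; rewrite mulr_sumr.
rewrite exchange_big; apply: eq_bigr => y _ /=.
rewrite exchange_big /= Rc_Cnorm2.
transitivity (\sum_z h y * Cconj (h z) * \sum_x Cconj (U x z) * U x y).
  apply: eq_bigr => z _; rewrite mulr_sumr; apply: eq_bigr => x _.
  by rewrite rmorphM; ring.
rewrite (bigD1 y)//= UU eqxx mulr1 big1 ?addr0// => z zy.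
by rewrite UU (negbTE zy) mulr0.
Qed.

Lemma isometry_card (X : finType) (U : X -> X -> C) :
  isometry_on U -> \sum_x \sum_y Cnorm2 (U x y) = #|X|%:R.
Proof.
move=> UU; rewrite exchange_big /=.
rewrite -sumr_const; apply: eq_bigr => y _; apply: Rc_inj.
rewrite rmorph_sum rmorph1; have := UU y y; rewrite eqxx mulr1n => <-.
by apply: eq_bigr => x _; rewrite /= Rc_Cnorm2 mulrC.
Qed.

Lemma re_conj_mul_le a b : re (Cconj a * b) *+ 2 <= Cnorm2 a + Cnorm2 b.
Proof.
rewrite -subr_ge0; apply: (le_trans (Cnorm2_ge0 (a - b))).
by rewrite /Cnorm2 /= !(RplusE, RoppE, RminusE, RmultE); nra.
Qed.

Lemma sum_fibres (X A : finType) (K : nmodType) (f : X -> A) (F : X -> K) :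
  \sum_u \sum_(x | f x == u) F x = \sum_x F x.
Proof. by rewrite [RHS](partition_big f predT). Qed.

Section Junta_overlap.
Variables (X A B : finType) (f : X -> A) (p : X -> B) (U : X -> X -> C).
Hypothesis unitU : isometry_on U.
(** That is, (f, p) is a bijection from [X] onto the product of [A] with the image of [p]. The image
    replaces [B] because the [p] used later, [off], is not surjective. *)
Hypothesis fp_bij : forall u y, exists x, forall z,
  (f z == u) && (p z == p y) = (z == x).

(* With [f] the restriction to T and [p] the restriction to T^c, [block] is the
   unnormalised partial trace of [U] over T^c. *)
Definition block (u v : A) : C :=
  \sum_(x | f x == u) \sum_(y | f y == v) if p x == p y then U x y else 0.

Lemma fibre_card u : #|[set x | f x == u]| = #|[set p x | x : X]|.
Proof.
rewrite -!sum1_card; under eq_bigl do rewrite inE.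
rewrite (partition_big p (fun c => c \in [set p x | x : X])) /=; last first.
  by move=> x _; apply: imset_f.
apply: eq_bigr => _ /imsetP[y _ ->].
have [x xE] := fp_bij u y.
by under eq_bigl do rewrite xE; rewrite big_pred1_eq.
Qed.

Lemma card_fibres : #|X| = (#|A| * #|[set p x | x : X]|)%N.
Proof.
rewrite -[LHS]sum1_card -(@sum_fibres X A nat f) -sum_nat_const.
by apply: eq_bigr => u _; rewrite -(fibre_card u) -sum1_card; apply: eq_bigl => x; rewrite inE.
Qed.

Lemma sum_block (F : A -> A -> C) :
  \sum_u \sum_v F u v * block u v =
  \sum_x \sum_y if p x == p y then F (f x) (f y) * U x y else 0.
Proof.
rewrite -(sum_fibres f); apply: eq_bigr => u _.
under eq_bigr do rewrite mulr_sumr.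
rewrite exchange_big; apply: eq_bigr => x /eqP fx /=.
rewrite -(sum_fibres f); apply: eq_bigr => v _.
rewrite mulr_sumr; apply: eq_bigr => y /eqP fy.
by rewrite fx fy; case: ifP; rewrite ?mulr0.
Qed.

Lemma sum_comp_f (F : A -> R) :
  \sum_x F (f x) = #|[set p x | x : X]|%:R * \sum_u F u.
Proof.
rewrite -(sum_fibres f) mulr_sumr; apply: eq_bigr => u _.
rewrite -(fibre_card u) mulr_natl -sumr_const; apply: eq_big => x; first by rewrite inE.
by move/eqP => ->.
Qed.

(** The form splits over the values c of [p] into terms <g_c, U h_c>, where g_c and h_c are copies
    of (conjugated) [g] and [h] on the slice p = c. Each term is controlled by the inequality of
    arithmetic and geometric means and by U preserving the norm of h_c; the number of slices gives
    the factor. *)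
Lemma block_contraction (g h : A -> C) :
  re (\sum_u \sum_v g u * block u v * Cconj (h v)) *+ 2 <=
  #|[set p x | x : X]|%:R * (\sum_u Cnorm2 (g u) + \sum_v Cnorm2 (h v)).
Proof.
rewrite mulrDr -!sum_comp_f.
have -> : \sum_u \sum_v g u * block u v * Cconj (h v) =
    \sum_c \sum_x Cconj (if p x == c then Cconj (g (f x)) else 0) *
      \sum_y U x y * (if p y == c then Cconj (h (f y)) else 0).
  under eq_bigr do under eq_bigr do rewrite mulrAC.
  rewrite (sum_block (fun u v => g u * Cconj (h v))) [RHS]exchange_big /=.
  apply: eq_bigr => x _.
  rewrite (bigD1 (p x))//= eqxx CconjK [X in _ + X]big1 ?addr0.
    rewrite mulr_sumr; apply: eq_bigr => y _; rewrite eq_sym.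
    by case: ifP => _; rewrite ?mulr0//; ring.
  by move=> c cx; rewrite eq_sym (negbTE cx) rmorph0 mul0r.
rewrite -(sum_fibres p (fun x => Cnorm2 (g (f x)))).
rewrite -(sum_fibres p (fun x => Cnorm2 (h (f x)))).
rewrite -big_split raddf_sum -sumrMnl; apply: ler_sum => c _ /=.
pose h' y := if p y == c then Cconj (h (f y)) else 0.
have -> : \sum_(x | p x == c) Cnorm2 (h (f x)) =
    \sum_x Cnorm2 (\sum_y U x y * h' y).
  rewrite isometry_norm// big_mkcond; apply: eq_bigr => y _; rewrite /h'.
  by case: ifP; rewrite ?Cnorm2_0// !Cnorm2_re CconjK mulrC.
rewrite [X in _ <= X + _]big_mkcond -big_split raddf_sum -sumrMnl; apply: ler_sum => x _ /=.
apply: le_trans (re_conj_mul_le _ _) _; rewrite lerD2r.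
by case: ifP; rewrite ?Cnorm2_0// !Cnorm2_re CconjK mulrC.
Qed.

(* [V] is the polar factor of [block], and the matrix [E] below is V_T (x) I. *)
Lemma near_junta : exists V : A -> A -> C, isometry_on V /\
  let E x y := if p x == p y then V (f x) (f y) else 0 in
  #|A|%:R * \sum_u \sum_v Cnorm2 (block u v) + 
     #|X|%:R * (\sum_x \sum_y Cnorm2 (U x y - E x y)) / 2 <= #|X|%:R ^+ 2.
Proof.
have [V [VU VZ]] := polar_lower_bound_C block_contraction.
exists V; split=> // E.
have EU : isometry_on E.
  move=> y z; rewrite /E.
  transitivity (\sum_(x | p x == p y) if p y == p z then
      Cconj (V (f x) (f y)) * V (f x) (f z) else 0).
    rewrite [RHS]big_mkcond; apply: eq_bigr => x _.
    case: eqP => [->|_]; last by rewrite rmorph0 mul0r.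
    by case: ifP; rewrite ?mulr0.
  have [pyz|pyz] := eqVneq (p y) (p z); last first.
    rewrite big1//; have [yz|//] := eqVneq y z; by rewrite yz eqxx in pyz.
  rewrite (partition_big f predT)//=.
  transitivity (\sum_u Cconj (V u (f y)) * V u (f z)).
    apply: eq_bigr => u _; have [x xE] := fp_bij u y.
    rewrite (big_pred1 x); last by move=> i; rewrite andbC xE.
    by have := xE x; rewrite eqxx => /andP[/eqP ->].
  rewrite VU; congr (nat_of_bool _)%:R; apply/eqP/eqP => [fyz|->//].
  have [x xE] := fp_bij (f y) y.
  have := xE y; rewrite !eqxx => /esym/eqP ->.
  by have := xE z; rewrite fyz pyz !eqxx => /esym/eqP ->.
(* Both [U] and [E] have squared norm #|X|, so their distance depends only on the overlap <E, U>,
   which equals <V, block>. *)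
have -> : \sum_x \sum_y Cnorm2 (U x y - E x y) = #|X|%:R *+ 2 -
    re (\sum_x \sum_y Cconj (E x y) * U x y) *+ 2.
  rewrite mulr2n -{1}(isometry_card unitU) -(isometry_card EU).
  rewrite raddf_sum -sumrMnl -big_split -sumrB; apply: eq_bigr => x _ /=.
  rewrite raddf_sum -sumrMnl -big_split -sumrB; apply: eq_bigr => y _ /=.
  by rewrite /Cnorm2 /= !(RplusE, RoppE, RminusE, RmultE); ring.
have -> : \sum_x \sum_y Cconj (E x y) * U x y =
    \sum_u \sum_v Cconj (V u v) * block u v.
  rewrite (sum_block (fun u v => Cconj (V u v))); apply: eq_bigr => x _.
  by apply: eq_bigr => y _; rewrite /E; case: ifP; rewrite // rmorph0 mul0r.
move: VZ; set S := \sum_u _; set T := re _; rewrite card_fibres natrM.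
set a := #|A|%:R; set b := _%:R => VZ.
have a0 : 0 <= a by rewrite ler0n.
have : a * S <= a * (b * T) by rewrite ler_wpM2l.
lra.
Qed.

End Junta_overlap.

(** * Pauli coefficients *)

Section Fourier.
Variable n : nat.
Local Notation X := {ffun 'I_n -> bool}.
Implicit Types (T : {set 'I_n}) (a b r x y : X).

Definition supp x : {set 'I_n} := [set q | x q].
Definition agree T x y := [forall q in T, x q == y q].

Definition chi b r : C := \prod_q (-1) ^+ (b q && r q).

Lemma chiD b x y : chi b (x + y) = chi b x * chi b y.
Proof.
rewrite -big_split; apply: eq_bigr => q _ /=; rewrite ffunE.
by case: (b q) (x q) (y q) => [] [] [] /=; rewrite ?expr1 ?expr0 ?mulrNN ?mulr1 ?mul1r.
Qed.

Lemma chi_conj b r : Cconj (chi b r) = chi b r.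
Proof. by rewrite rmorph_prod; apply: eq_bigr => q _; rewrite rmorphXn rmorphN1. Qed.

Lemma addXX x : x + x = 0.
Proof. by apply/ffunP => q; rewrite !ffunE; case: (x q). Qed.

Lemma addXK y : involutive (fun x => x + y).
Proof. by move=> x; rewrite -addrA addXX addr0. Qed.

(** The sum factorises over qubits: one in T contributes 2 if x and y agree there and 0 otherwise,
    one outside T contributes 1. *)
Lemma sum_chi T x y :
  \sum_(b | supp b \subset T) chi b x * chi b y = (2 ^ #|T| * agree T x y)%:R.
Proof.
transitivity (\prod_q \sum_(e : bool | e ==> (q \in T))
    ((-1) ^+ (e && x q) * (-1) ^+ (e && y q)) : C).
  rewrite bigA_distr_big_dep; apply: eq_big => [b|b _]; last exact: esym (big_split _ _ _ _ _).
  apply/subsetP/familyP => bT q; first by apply/implyP => bq; apply: bT; rewrite inE.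
  by rewrite inE => bq; have /implyP := bT q; exact.
transitivity (\prod_q (if q \in T then (2 * (x q == y q))%:R else 1) : C).
  apply: eq_bigr => q _; rewrite big_mkcond big_bool /=.
  case: (q \in T); last by rewrite add0r mulr1.
  by case: (x q) (y q) => [] [] /=; rewrite ?expr1 ?expr0 ?mulrNN ?mulr1 ?mul1r ?addNr.
rewrite -big_mkcond -natr_prod big_split /= prod_nat_const; congr (_ * _)%:R.
rewrite /agree; case: forallP => [xy|/forallP].
  by rewrite big1// => q qT; have /implyP/(_ qT) -> := xy q.
rewrite negb_forall => /existsP[q]; rewrite negb_imply => /andP[qT xy].
by rewrite (bigD1 q)//= (negbTE xy).
Qed.

(** Addition in [X] is bitwise xor, and X^a Z^b sends |r> to [chi b r] |r + a>. So this is the trace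
    of (X^a Z^b)^dagger U, that is, N times a Pauli coefficient up to a phase. *)
Definition phi (U : X -> X -> C) a b : C := \sum_r chi b r * U (r + a) r.

Lemma agree_subr T x y : (supp (x - y) \subset ~: T) = agree T x y.
Proof.
apply/subsetP/forall_inP => h q.
  move=> qT; apply: contraTT qT => xy; rewrite -in_setC; apply: h.
  by rewrite inE !ffunE; case: (x q) (y q) xy => [] [].
rewrite inE !ffunE inE => xy; apply: contraTN xy => qT.
by have /eqP -> := h q qT; case: (y q).
Qed.

Section Restriction.
Variables (T : {set 'I_n}) (A : finType) (f : X -> A).
Hypothesis f_agree : forall x y, (f x == f y) = agree T x y.
Hypothesis f_surj : forall u, exists x, f x = u.

(** Restriction to the complement of T, kept as a full string zeroed on T so that its type does not
    depend on T. *)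
Definition off x : X := [ffun q => (q \notin T) && x q].

Lemma off_agree x y : (off x == off y) = agree (~: T) x y.
Proof.
apply/eqP/forall_inP => [/ffunP xy q|xy].
  by rewrite inE => qT; have := xy q; rewrite !ffunE qT => /= ->.
apply/ffunP => q; rewrite !ffunE; case: (boolP (q \in T)) => //= qT.
by apply/eqP/xy; rewrite inE.
Qed.

Lemma restriction_bij u y : exists x, forall z,
  (f z == u) && (off z == off y) = (z == x).
Proof.
have [x0 <-] := f_surj u; exists [ffun q => if q \in T then x0 q else y q] => z.
rewrite f_agree off_agree.
apply/andP/eqP => [[/forall_inP zx /forall_inP zy]|->].
  apply/ffunP => q; rewrite ffunE; case: (boolP (q \in T)) => qT; apply/eqP.
    exact: zx.
  by apply: zy; rewrite inE.
by split; apply/forall_inP => q; rewrite ?inE => qT; rewrite ffunE ?qT// (negbTE qT).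
Qed.

(** Parseval for the partial trace: a Pauli string supported in T has the same trace pairing with U
    as its restriction to T has with [block]. In the computation, the sum over b forces the two
    column indices to agree on T and yields 2^|T|. *)
Lemma fourier_weight U :
  \sum_(a | supp a \subset T) \sum_(b | supp b \subset T) Cnorm2 (phi U a b) =
  (2 ^ #|T|)%:R * \sum_u \sum_v Cnorm2 (block f off U u v).
Proof.
apply: Rc_inj; rewrite rmorphM rmorph_nat !rmorph_sum /=.
pose S a := \sum_x \sum_(y | agree T x y) U (x + a) x * Cconj (U (y + a) y).
transitivity ((2 ^ #|T|)%:R * \sum_(a | supp a \subset T) S a).
  rewrite mulr_sumr; apply: eq_bigr => a _; rewrite rmorph_sum /=.
  transitivity (\sum_x \sum_y \sum_(b | supp b \subset T)
      (chi b x * chi b y) * (U (x + a) x * Cconj (U (y + a) y))).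
    under [RHS]eq_bigr do rewrite exchange_big /=.
    rewrite [RHS]exchange_big /=; apply: eq_bigr => b _.
    rewrite Rc_Cnorm2 /phi rmorph_sum mulr_suml; apply: eq_bigr => x _.
    rewrite mulr_sumr; apply: eq_bigr => y _.
    by rewrite rmorphM /= chi_conj; ring.
  rewrite /S mulr_sumr; apply: eq_bigr => x _.
  rewrite mulr_sumr [RHS]big_mkcond; apply: eq_bigr => y _.
  rewrite -mulr_suml sum_chi; case: ifP => _; first by rewrite muln1.
  by rewrite muln0 mul0r.
congr (_ * _).
(* The entries summed in this block are exactly those whose row is the column z shifted by the fixed
   string x - y, which is supported in T. *)
have blockE x y : off x == off y ->
    block f off U (f x) (f y) = \sum_(z | agree T y z) U (z + (x - y)) z.
  move=> xy; rewrite /block exchange_big /=.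
  apply: eq_big => [z|z fz]; first by rewrite eq_sym f_agree.
  rewrite -big_mkcondr /= (big_pred1 (z + (x - y)))// => w.
  move: xy fz; rewrite !f_agree !off_agree.
  move=> /forall_inP xy /forall_inP yz.
  apply/andP/eqP => [[/forall_inP wx /forall_inP wz]|->].
    apply/ffunP => q; rewrite !ffunE; case: (boolP (q \in T)) => qT.
      by rewrite (eqP (wx q qT)) (eqP (yz q qT)); case: (x q) (y q) => [] [].
    have qT' : q \in ~: T by rewrite inE.
    by rewrite (eqP (wz q qT')) (eqP (xy q qT')); case: (y q) (z q) => [] [].
  split; apply/forall_inP => q qT; rewrite !ffunE.
    by rewrite (eqP (yz q qT)); case: (x q) (y q) => [] [].
  by rewrite (eqP (xy q qT)); case: (z q) (y q) => [] [].
transitivity (\sum_x \sum_y if off x == off y then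
   Cconj (block f off U (f x) (f y)) * U x y else 0); last first.
  rewrite -(sum_block f off U (fun u v => Cconj (block f off U u v))).
  apply: eq_bigr => u _; rewrite rmorph_sum; apply: eq_bigr => v _ /=.
  by rewrite Rc_Cnorm2 mulrC.
rewrite [RHS]exchange_big /S [LHS]exchange_big; apply: eq_bigr => y _ /=.
(* Rows are written a + y; having the same [off] part as y then means that a is supported in T. *)
rewrite [RHS](reindex_inj (can_inj (addXK y))) big_mkcond; apply: eq_bigr => a _ /=.
rewrite off_agree -agree_subr setCK addrK; case: ifP => // aT.
rewrite blockE; last by rewrite off_agree -agree_subr setCK addrK.
rewrite rmorph_sum mulr_suml; apply: eq_bigr => z _.
by rewrite addrK mulrC [a + y]addrC.
Qed.

(** Take a qubit q outside T in the support. If a has bit q, row and column differ off T and every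
    entry is 0. If only b has it, flipping bit q of r negates each term, so the sum equals its
    opposite. *)
Lemma phi_junta (G : A -> A -> C) a b : ~~ (supp a :|: supp b \subset T) ->
  phi (fun x y => if off x == off y then G (f x) (f y) else 0) a b = 0.
Proof.
move=> /subsetPn[q qab qT]; rewrite /phi.
have [aq|aq] := boolP (a q).
  rewrite big1// => r _; rewrite off_agree; case: ifP; rewrite ?mulr0//.
  move=> /forall_inP/(_ q); rewrite inE qT ffunE aq => /(_ isT).
  by case: (r q).
have bq : b q by move: qab; rewrite !inE (negbTE aq).
pose d : X := [ffun i => i == q].
have bd : chi b d = -1.
  rewrite /chi (bigD1 q)//= ffunE eqxx bq expr1 big1 ?mulr1// => i iq.
  by rewrite ffunE (negbTE iq) andbF.
have fd x : f (x + d) = f x.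
  apply/eqP; rewrite f_agree; apply/forall_inP => i iT; rewrite !ffunE.
  have -> : (i == q) = false by apply: contraNF qT => /eqP <-.
  by case: (x i).
set S := (X in X = 0); have SN : S = - S.
  rewrite {1}/S (reindex_inj (can_inj (addXK d))) -sumrN; apply: eq_bigr => r _ /=.
  rewrite chiD bd fd addrAC fd mulrN1 !off_agree -!agree_subr.
  have -> : r + a + d - (r + d) = r + a - r by rewrite opprD addrACA subrr addr0.
  by rewrite mulNr.
apply: C_eq.
  have := congr1 re SN; rewrite /= !(RoppE, R0E); lra.
have := congr1 im SN; rewrite /= !(RoppE, R0E); lra.
Qed.

End Restriction.

(** The case of all qubits with f the identity: fibres are singletons, [off] is constant, and
    [block] is U itself. *)
Lemma fourier_total U : isometry_on U ->
  \sum_a \sum_b Cnorm2 (phi U a b) = (2 ^ n)%:R ^+ 2.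
Proof.
move=> UU; have id_agree x y : (id x == id y) = agree setT x y.
  apply/eqP/forall_inP => [->//|xy]; apply/ffunP => q; exact/eqP/xy.
have := fourier_weight id_agree U.
rewrite cardsT card_ord.
under eq_bigl do rewrite subsetT.
under eq_bigr do under eq_bigl do rewrite subsetT.
move=> ->; rewrite expr2; congr (_ * _).
transitivity (\sum_x \sum_y Cnorm2 (U x y)); last first.
  by rewrite isometry_card// card_ffun card_bool card_ord.
apply: eq_bigr => x _; apply: eq_bigr => y _; congr Cnorm2.
rewrite /block (big_pred1 x); last by move=> z; rewrite eq_sym.
rewrite (big_pred1 y); last by move=> z; rewrite eq_sym.
by rewrite off_agree setCT; case: ifP => // /forall_inP[]// q; rewrite inE.
Qed.

End Fourier.

(** * Operators on product states *)

Lemma pow_expn a b : Nat.pow a b = (a ^ b)%N.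
Proof. by elim: b => [//|b IH]; rewrite expnS -IH. Qed.

Lemma sum_nat_mul (K : nmodType) d e (F : nat -> K) :
  \sum_(i < d * e) F i = \sum_(t < e) \sum_(s < d) F (s + d * t)%N.
Proof.
elim: e => [|e IH]; first by rewrite muln0 !big_ord0.
rewrite mulnS addnC big_split_ord big_ord_recr /= -IH; congr (_ + _).
by apply: eq_bigr => s _; rewrite addnC.
Qed.

Lemma ltn_pair d e s t : (s < d)%N -> (t < e)%N -> (s + d * t < d * e)%N.
Proof. by move=> sd te; nia. Qed.

Lemma modn_pair d s t : (s < d)%N -> ((s + d * t) %% d)%N = s.
Proof. by move=> sd; rewrite mulnC addnC modnMDl modn_small. Qed.

Lemma divn_pair d s t : (s < d)%N -> ((s + d * t) %/ d)%N = t.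
Proof.
move=> sd; rewrite mulnC addnC divnMDl ?(leq_ltn_trans _ sd)//.
by rewrite divn_small// addn0.
Qed.

Lemma pair_eta d e i : (i < d * e)%N ->
  exists s t, [/\ (s < d)%N, (t < e)%N & i = (s + d * t)%N].
Proof.
case: d => [|d]; first by rewrite mul0n.
move=> id; exists (i %% d.+1)%N, (i %/ d.+1)%N; split; first by rewrite ltn_pmod.
  by rewrite ltn_divLR// mulnC.
by rewrite addnC mulnC -divn_eq.
Qed.

Lemma Nat_div_pair d s t : (s < d)%N -> Nat.div (s + d * t) d = t.
Proof. by move=> sd; symmetry; apply: (Nat.div_unique _ _ _ s); lia. Qed.

Lemma Nat_mod_pair d s t : (s < d)%N -> Nat.modulo (s + d * t) d = s.
Proof. by move=> sd; symmetry; apply: (Nat.mod_unique _ _ t); lia. Qed.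

Lemma Nat_eqbE (i j : nat) : Nat.eqb i j = (i == j).
Proof. by apply/idP/eqP => [/Nat.eqb_eq|/Nat.eqb_eq]. Qed.

Lemma sum_delta (K : nmodType) d (F : nat -> K) i : (i < d)%N ->
  \sum_(j < d) (if i == j :> nat then F j else 0) = F i.
Proof.
move=> id; rewrite -big_mkcond (big_pred1 (Ordinal id)) // => j; exact: eq_sym.
Qed.

Lemma mvecE d A v i : mvec d A v i = \sum_(l < d) A i l * v l.
Proof. exact: Csum_big. Qed.

Lemma mmulE d A B i j : mmul d A B i j = \sum_(l < d) A i l * B l j.
Proof. exact: (Csum_big _ (fun l => A i l * B l j)). Qed.

Lemma vnorm2E d v : vnorm2 d v = \sum_(i < d) Cnorm2 (v i).
Proof. exact: (Rsum_big _ (fun i => Cnorm2 (v i))). Qed.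

Lemma idmE i j : idm i j = (i == j)%:R.
Proof. by rewrite /idm Nat_eqbE; case: eqP. Qed.

Lemma unitary_isometry d U : unitary d U <->
  isometry_on (fun x y : 'I_d => U x y).
Proof.
split=> [h x y|h i j /ssrnat.ltP id /ssrnat.ltP jd].
  have := h x y (elimT ssrnat.ltP (ltn_ord x)) (elimT ssrnat.ltP (ltn_ord y)).
  by rewrite mmulE idmE.
by have := h (Ordinal id) (Ordinal jd); rewrite mmulE idmE.
Qed.

Lemma unitary_idm d : unitary d idm.
Proof.
apply/unitary_isometry => y z.
under eq_bigr do rewrite !idmE rmorph_nat.
rewrite (bigD1 y)//= eqxx mul1r big1 ?addr0// => x xy.
by rewrite (negbTE xy : (val x == val y) = false) mul0r.
Qed.

Lemma mvec_tens d e A v s t : (s < d)%N -> (t < e)%N ->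
  mvec (d * e) (tens_id d A) v (s + d * t)%N =
  \sum_(l < d) A s l * v (l + d * t)%N.
Proof.
move=> sd te; rewrite mvecE (sum_nat_mul _ _ (fun j => tens_id d A (s + d * t)%N j * v j)).
rewrite (bigD1 (Ordinal te))//= [X in _ + X]big1 ?addr0; last first.
  move=> t' tt'; apply: big1 => l _.
  rewrite /tens_id !Nat_div_pair// Nat_eqbE eq_sym.
  by rewrite (negbTE tt' : (val t' == t) = false) mul0r.
apply: eq_bigr => l _.
by rewrite /tens_id !Nat_div_pair// !Nat_mod_pair// Nat_eqbE eqxx.
Qed.

(* Writing a row index as [x + e * b] and a column index as [c + d * y], this is
   [A] applied to the first tensor factor (of dimension [d]), which is then moved
   to the last position. *)
Definition rot_op d e (A : Mat) : Mat := fun i j =>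
  if (i %% e == j %/ d)%N then A (i %/ e)%N (j %% d)%N else 0.

Lemma mvec_rot d e A v x b : (x < e)%N -> (b < d)%N ->
  mvec (d * e) (rot_op d e A) v (x + e * b)%N =
  \sum_(c < d) A b c * v (c + d * x)%N.
Proof.
move=> xe bd; rewrite mvecE (sum_nat_mul _ _ (fun j => rot_op d e A (x + e * b)%N j * v j)).
rewrite -(sum_delta (fun y => \sum_(c < d) A b c * v (c + d * y)%N) xe).
apply: eq_bigr => y _; rewrite /rot_op modn_pair// divn_pair//.
transitivity (\sum_(c < d) if x == y :> nat then A b c * v (c + d * y)%N else 0).
  apply: eq_bigr => c _; rewrite modn_pair// divn_pair//.
  by case: ifP; rewrite ?mul0r.
by case: ifP => // _; rewrite big1.
Qed.

Lemma unitary_rot d e A : unitary d A -> unitary (d * e) (rot_op d e A).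
Proof.
move/unitary_isometry => AA i j /ssrnat.ltP id /ssrnat.ltP jd; rewrite mmulE idmE.
have [c [x [cd xe ->]]] := pair_eta id; have [c' [x' [cd' xe' ->]]] := pair_eta jd.
rewrite mulnC (sum_nat_mul _ _ (fun l =>
  adj (rot_op d e A) (c + d * x)%N l * rot_op d e A l (c' + d * x')%N)).
transitivity (\sum_(b < d) \sum_(y < e) if x == y :> nat then
    if x' == y then Cconj (A b c) * A b c' else 0 else 0).
  apply: eq_bigr => b _; apply: eq_bigr => y _.
  rewrite /adj /rot_op !modn_pair// !divn_pair// (eq_sym x) (eq_sym x').
  by case: ifP; case: ifP; rewrite ?mulr0 ?rmorph0 ?mul0r.
under eq_bigr do rewrite (sum_delta (fun y => if x' == y then _ else 0))//.
have -> : (c + d * x == c' + d * x')%N = (x' == x) && (c == c').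
  apply/eqP/andP => [h|[/eqP -> /eqP ->]//]; split; apply/eqP.
    by rewrite -(divn_pair x cd) h divn_pair.
  by rewrite -(modn_pair x cd) h modn_pair.
case: eqP => _ /=; last by rewrite big1.
exact: (AA (Ordinal cd) (Ordinal cd')).
Qed.

(** Tensor product of a list, read off the base-M digits of i. The head is the lowest digit, hence
    the pair whose low half [tens_id] acts on. *)
Fixpoint prodv M (s : seq Vec) (i : nat) : C :=
  if s is v :: s' then v (i %% M)%N * prodv M s' (i %/ M)%N else 1.

Lemma prodv_cons M v s p a : (p < M)%N ->
  prodv M (v :: s) (p + M * a)%N = v p * prodv M s a.
Proof. by move=> pM; rewrite /= modn_pair// divn_pair. Qed.

Lemma prodv_rcons M s v a b : (a < M ^ size s)%N -> (b < M)%N ->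
  prodv M (rcons s v) (a + M ^ size s * b)%N = prodv M s a * v b.
Proof.
elim: s a => [|u s IH] a; rewrite ?expnS.
  by case: a => // _ bM; rewrite mul1n add0n /= modn_small// mulr1 mul1r.
move=> aM bM; have [p [c [pM cM ->]]] := pair_eta aM.
rewrite rcons_cons -mulnA -addnA -mulnDr !prodv_cons//.
by rewrite IH// mulrA.
Qed.

Lemma sum_prodv_norm M v m :
  \sum_(i < M ^ m) Cnorm2 (prodv M (nseq m v) i) = (\sum_(p < M) Cnorm2 (v p)) ^+ m.
Proof.
elim: m => [|m IH]; first by rewrite expn0 big_ord1 Cnorm2_1.
rewrite expnS (sum_nat_mul _ _ (fun i => Cnorm2 (prodv M (nseq m.+1 v) i))).
rewrite exprSr -IH mulr_suml; apply: eq_bigr => a _.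
rewrite mulr_sumr; apply: eq_bigr => p _.
by rewrite prodv_cons// Cnorm2M mulrC.
Qed.

Lemma mvec_tens_prodv N e U v s i : (i < N * (N * e))%N ->
  mvec (N * (N * e)) (tens_id N U) (prodv (N * N) (v :: s)) i =
  prodv (N * N) (mvec (N * N) (tens_id N U) v :: s) i.
Proof.
move=> iN; have [x [z [xN zN ->]]] := pair_eta iN.
rewrite mvec_tens//; have [r [a [rN aN ->]]] := pair_eta zN.
have E w : (w < N)%N -> (w + N * (r + N * a) = (w + N * r) + N * N * a)%N by lia.
rewrite E// prodv_cons ?ltn_pair// mvec_tens// mulr_suml; apply: eq_bigr => l _.
by rewrite E// prodv_cons ?ltn_pair// mulrA.
Qed.

Lemma mvec_rot_prodv M A v s i : (i < M * M ^ size s)%N ->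
  mvec (M * M ^ size s) (rot_op M (M ^ size s) A) (prodv M (v :: s)) i =
  prodv M (rcons s (mvec M A v)) i.
Proof.
rewrite {1}mulnC => iM; have [x [b [xe bM ->]]] := pair_eta iM.
rewrite mvec_rot// prodv_rcons// mvecE mulr_sumr; apply: eq_bigr => c _.
by rewrite prodv_cons//; ring.
Qed.

Lemma mvec_ext d A v w i : (forall j, (j < d)%N -> v j = w j) ->
  mvec d A v i = mvec d A w i.
Proof. by move=> vw; rewrite !mvecE; apply: eq_bigr => j _; rewrite vw. Qed.

Lemma mvec_idm d v i : (i < d)%N -> mvec d idm v i = v i.
Proof.
move=> id; rewrite mvecE -[RHS](sum_delta v id); apply: eq_bigr => j _.
by rewrite idmE; case: eqP; rewrite ?mul1r ?mul0r.
Qed.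

(** * Bell measurement *)

Section Bits.
Variable n : nat.
Local Notation X := {ffun 'I_n -> bool}.

Definition bits (i : nat) : X := [ffun q : 'I_n => Nat.testbit i q].

Lemma testbit_high i q : (i < 2 ^ n)%N -> (n <= q)%N -> Nat.testbit i q = false.
Proof.
case: i => [|i] iN nq; first exact: Nat.bits_0.
apply: Nat.bits_above_log2; apply: (Nat.lt_le_trans _ n); last exact/ssrnat.leP.
by apply/Nat.log2_lt_pow2; [lia|rewrite pow_expn; exact/ssrnat.ltP].
Qed.

Lemma bits_inj i j : (i < 2 ^ n)%N -> (j < 2 ^ n)%N -> bits i = bits j -> i = j.
Proof.
move=> iN jN /ffunP ij; apply: Nat.bits_inj => q.
have [nq|qn] := leqP n q; first by rewrite !testbit_high.
by have := ij (Ordinal qn); rewrite !ffunE.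
Qed.

(** The default 0 never occurs: [bits] is injective below 2^n, hence bijective by counting. *)
Definition unbits (x : X) : nat :=
  if [pick i : 'I_(2 ^ n) | bits i == x] is Some i then val i else 0%N.

Lemma bits_ord_bij : bijective (fun i : 'I_(2 ^ n) => bits i).
Proof.
apply: inj_card_bij; last by rewrite card_ffun card_bool !card_ord.
by move=> i j /= ij; apply: ord_inj; apply: bits_inj ij; apply: ltn_ord.
Qed.

Lemma unbitsK : cancel unbits bits.
Proof.
move=> x; rewrite /unbits; case: pickP => [i /eqP //|none].
by have [g _ gK] := bits_ord_bij; have := none (g x); rewrite gK eqxx.
Qed.

Lemma unbits_lt x : (unbits x < 2 ^ n)%N.
Proof. by rewrite /unbits; case: pickP => [i _|_]; rewrite ?expn_gt0 ?ltn_ord. Qed.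

Lemma bitsK i : (i < 2 ^ n)%N -> unbits (bits i) = i.
Proof. by move=> iN; apply: bits_inj => //; rewrite ?unbitsK ?unbits_lt. Qed.

Lemma sum_bits (K : nmodType) (F : nat -> K) :
  \sum_(i < 2 ^ n) F i = \sum_x F (unbits x).
Proof.
rewrite (reindex _ (onW_bij _ bits_ord_bij)).
by apply: eq_bigr => i _; rewrite bitsK.
Qed.

Definition on_bits (U : Mat) : X -> X -> C := fun x y => U (unbits x) (unbits y).

Lemma on_bits_isometry U : unitary (2 ^ n)%N U -> isometry_on (on_bits U).
Proof.
move=> UU y z; have := UU (unbits y) (unbits z).
rewrite mmulE idmE (sum_bits (fun l => adj U _ l * U l _)) => -> //; last 2 first.
- exact/ssrnat.ltP/unbits_lt.
- exact/ssrnat.ltP/unbits_lt.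
by rewrite (can_eq unbitsK).
Qed.

Local Notation N := (2 ^ n)%N.
Definition inv_sqrt_dim : R := (Num.sqrt N%:R)^-1.

Lemma inv_sqrt_dim_sq : inv_sqrt_dim * inv_sqrt_dim = N%:R^-1.
Proof. by rewrite -invfM -expr2 sqr_sqrtr ?ler0n. Qed.

Definition max_ent : Vec := fun p =>
  if (p %/ N == p %% N)%N then Rc inv_sqrt_dim else 0.

(* Row [a + N * b] is the vectorised Pauli operator X^a Z^b / sqrt N; the column
   index [s + N * r] refers to its matrix entry in row [s] and column [r]. *)
Definition bell : Mat := fun y p =>
  if bits (p %% N) + bits (p %/ N) == bits (y %% N)
  then chi (bits (y %/ N)) (bits (p %/ N)) * Rc inv_sqrt_dim else 0.

Definition pauli_amplitude (U : Mat) : Vec :=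
  mvec (N * N) bell (mvec (N * N) (tens_id N U) max_ent).

Lemma vnorm_max_ent : \sum_(p < N * N) Cnorm2 (max_ent p) = 1.
Proof.
rewrite (sum_nat_mul _ _ (fun p => Cnorm2 (max_ent p))).
transitivity (\sum_(r < N) (N%:R : R)^-1).
  apply: eq_bigr => r _.
  rewrite -inv_sqrt_dim_sq -expr2 -Cnorm2_Rc.
  rewrite -(sum_delta (fun _ => Cnorm2 (Rc inv_sqrt_dim)) (ltn_ord r)).
  apply: eq_bigr => s _; rewrite /max_ent modn_pair// divn_pair//.
  by case: ifP; rewrite // Cnorm2_0.
by rewrite sumr_const card_ord -[_^-1 *+ _]mulr_natl divff// pnatr_eq0 -lt0n expn_gt0.
Qed.

Lemma natr_mul_RcV k : (0 < k)%N -> k%:R * Rc (k%:R^-1) = 1.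
Proof.
move=> k0; rewrite -(rmorph_nat Rc) -rmorphM divff ?rmorph1//.
by rewrite pnatr_eq0 -lt0n.
Qed.

(** For columns (s, r) and (s', r'), the sum over a forces s + r = s' + r' and the character sum
    over b gives N when r = r' and 0 otherwise, cancelling the normalisation. *)
Lemma unitary_bell : unitary (N * N)%N bell.
Proof.
move=> i j /ssrnat.ltP iM /ssrnat.ltP jM; rewrite mmulE idmE.
have [s [r [sN rN ->]]] := pair_eta iM; have [s' [r' [sN' rN' ->]]] := pair_eta jM.
rewrite (sum_nat_mul _ _ (fun l => adj bell (s + N * r)%N l * bell l (s' + N * r')%N)).
pose G (a b : X) := if bits s + bits r == a then
  if bits s' + bits r' == a then chi b (bits r) * chi b (bits r') * Rc (N%:R^-1)
  else 0 else 0.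
transitivity (\sum_b \sum_a G a b).
  rewrite (sum_bits (fun b => \sum_(a < N) adj bell (s + N * r)%N (a + N * b)%N *
    bell (a + N * b)%N (s' + N * r')%N)).
  apply: eq_bigr => b _.
  rewrite (sum_bits (fun a => adj bell (s + N * r)%N (a + N * unbits b)%N *
    bell (a + N * unbits b)%N (s' + N * r')%N)).
  apply: eq_bigr => a _; rewrite /adj /bell /G.
  rewrite !modn_pair ?unbits_lt// !divn_pair ?unbits_lt// !unbitsK.
  case: ifP; last by rewrite rmorph0 mul0r.
  case: ifP; rewrite ?mulr0// => _ _.
  by rewrite rmorphM /= chi_conj Cconj_Rc -inv_sqrt_dim_sq rmorphM /=; ring.
have -> : (s + N * r == s' + N * r')%N = (bits s == bits s') && (bits r == bits r').
  apply/eqP/andP => [h|[/eqP ss /eqP rr]]; last first.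
    by rewrite (bits_inj sN sN' ss) (bits_inj rN rN' rr).
  have rr : r = r' by rewrite -(divn_pair r sN) h divn_pair.
  have ss : s = s' by rewrite -(modn_pair r sN) h modn_pair.
  by rewrite rr ss !eqxx.
have -> : \sum_b \sum_a G a b = if bits s + bits r == bits s' + bits r' then
    (\sum_(b | supp b \subset setT) chi b (bits r) * chi b (bits r')) *
    Rc (N%:R^-1) else 0.
  case: ifP => h.
    rewrite mulr_suml; apply: eq_big => b; first by rewrite subsetT.
    rewrite (bigD1 (bits s + bits r))//= /G eqxx eq_sym h big1 ?addr0// => a /negbTE.
    by rewrite eq_sym => ->.
  rewrite big1// => b _; rewrite big1// => a _; rewrite /G.
  by case: eqP => // <-; rewrite eq_sym h.
rewrite sum_chi cardsT card_ord.
have -> : agree setT (bits r) (bits r') = (bits r == bits r').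
  apply/forall_inP/eqP => [h|->//]; apply/ffunP => q; exact/eqP/h.
have [->|rr] := eqVneq (bits r) (bits r'); last first.
  by rewrite andbF muln0 mul0r; case: ifP.
by rewrite (inj_eq (addIr _)) andbT muln1 natr_mul_RcV ?expn_gt0//; case: eqP.
Qed.

(** Querying half of [max_ent] produces the vectorisation of U over sqrt N; the second factor 1 /
    sqrt N comes from [bell]. In the row of (a, b), only the entries with s = r + a survive. *)
Lemma pauli_amplitudeE U a b : (a < N)%N -> (b < N)%N ->
  pauli_amplitude U (a + N * b)%N =
  Rc (N%:R^-1) * phi (on_bits U) (bits a) (bits b).
Proof.
move=> aN bN; rewrite /pauli_amplitude mvecE.
rewrite (sum_nat_mul _ _ (fun l => bell (a + N * b)%N l *
  mvec (N * N) (tens_id N U) max_ent l)).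
rewrite (sum_bits (fun r => \sum_(s < N) bell (a + N * b)%N (s + N * r)%N *
  mvec (N * N) (tens_id N U) max_ent (s + N * r)%N)).
rewrite /phi mulr_sumr; apply: eq_bigr => r _.
rewrite (sum_bits (fun s => bell (a + N * b)%N (s + N * unbits r)%N *
  mvec (N * N) (tens_id N U) max_ent (s + N * unbits r)%N)).
rewrite (bigD1 (r + bits a))//= [X in _ + X]big1 ?addr0.
  rewrite /bell !modn_pair ?unbits_lt// !divn_pair ?unbits_lt// !unbitsK.
  rewrite addrAC addXX add0r eqxx mvec_tens ?unbits_lt//.
  transitivity (chi (bits b) r * Rc inv_sqrt_dim *
    (\sum_(l < N) if unbits r == l :> nat then
      U (unbits (r + bits a)) l * Rc inv_sqrt_dim else 0)).
    congr (_ * _); apply: eq_bigr => l _; rewrite /max_ent.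
    by rewrite modn_pair// divn_pair//; case: ifP; rewrite ?mulr0.
  rewrite (sum_delta (fun l => U (unbits (r + bits a)) l * _)) ?unbits_lt//.
  by rewrite -inv_sqrt_dim_sq rmorphM /= /on_bits; ring.
move=> s sr; rewrite /bell !modn_pair ?unbits_lt// !divn_pair ?unbits_lt// !unbitsK.
case: eqP => [h|_]; last by rewrite mul0r.
by case/eqP: sr; rewrite -h addrA addrAC addXX add0r.
Qed.

(** Outcome y = a + N * b stands for X^a Z^b, which is nontrivial on a qubit exactly when a or b has
    that bit. *)
Definition pauli_supp (y : nat) : {set 'I_n} :=
  supp (bits (y %% N)) :|: supp (bits (y %/ N)).

Lemma pauli_weight U (T : {set 'I_n}) :
  \sum_(y < N * N | pauli_supp y \subset T) Cnorm2 (pauli_amplitude U y) =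
  (\sum_(a | supp a \subset T) \sum_(b | supp b \subset T)
     Cnorm2 (phi (on_bits U) a b)) / N%:R ^+ 2.
Proof.
pose G (a b : X) : R := if supp a :|: supp b \subset T then
  Cnorm2 (phi (on_bits U) a b) / N%:R ^+ 2 else 0.
transitivity (\sum_b \sum_a G a b).
  rewrite big_mkcond (sum_nat_mul _ _ (fun y => if pauli_supp y \subset T then
    Cnorm2 (pauli_amplitude U y) else 0)).
  rewrite (sum_bits (fun b => \sum_(a < N) if pauli_supp (a + N * b)%N \subset T then
    Cnorm2 (pauli_amplitude U (a + N * b)%N) else 0)).
  apply: eq_bigr => b _.
  rewrite (sum_bits (fun a => if pauli_supp (a + N * unbits b)%N \subset T then
    Cnorm2 (pauli_amplitude U (a + N * unbits b)%N) else 0)).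
  apply: eq_bigr => a _; rewrite /G /pauli_supp.
  rewrite modn_pair ?unbits_lt// divn_pair ?unbits_lt// pauli_amplitudeE ?unbits_lt//.
  by rewrite !unbitsK Cnorm2M Cnorm2_Rc exprVn mulrC.
rewrite exchange_big mulr_suml [RHS]big_mkcond; apply: eq_bigr => a _ /=.
rewrite /G; case: ifP => aT; last by rewrite big1// => b _; rewrite subUset aT.
rewrite mulr_suml [RHS]big_mkcond; apply: eq_bigr => b _.
by rewrite subUset aT.
Qed.

End Bits.

(** * The tester *)

Section Algorithm.
Variables (n k : nat).
Local Notation N := (2 ^ n)%N.
Local Notation M := (N * N)%N.

Fixpoint seen m (S : {set 'I_n}) i : {set 'I_n} :=
  if m is m'.+1 then seen m' (S :|: pauli_supp n (i %% M)%N) (i %/ M)%N else S.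

(** There are m + 1 pairs; the system itself is half of the first one, so the ancilla has dimension
    N * M^m. [ops 0] precedes every query and does nothing; each later operation changes the queried
    pair to the Bell basis and sends it to the back, bringing the next pair under the black box. *)
Definition junta_alg m : algorithm :=
  {| anc := (N * M ^ m)%N; nq := m.+1;
     init := prodv M (nseq m.+1 (max_ent n));
     ops := fun j => if j is 0%N then idm else rot_op M (M ^ m)%N (bell n);
     acc_proj := fun i j =>
       if (i == j) && (#|seen m.+1 set0 i| <= k)%N then 1 else 0 |}.

(** The classical process: the probability that m further independent samples from p, added to S,
    leave at most k qubits. *)
Fixpoint accept_from (p : nat -> R) m (S : {set 'I_n}) : R :=
  if m is m'.+1 then \sum_(y < M) p y * accept_from p m' (S :|: pauli_supp n y)
  else (#|S| <= k)%:R.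

Lemma dim_alg m : (N * (N * M ^ m))%N = (M ^ m.+1)%N.
Proof. by rewrite expnS mulnA. Qed.

Lemma dim_junta_alg m : Nat.mul N (anc (junta_alg m)) = (M ^ m.+1)%N.
Proof. exact: dim_alg. Qed.

Lemma acc_projE m v i : (i < M ^ m.+1)%N ->
  mvec (M ^ m.+1) (acc_proj (junta_alg m)) v i =
  if (#|seen m.+1 set0 i| <= k)%N then v i else 0.
Proof.
move=> iM; rewrite mvecE /=.
transitivity (\sum_(j < M ^ m.+1) if i == j :> nat then
    (if (#|seen m.+1 set0 i| <= k)%N then v j else 0) else 0).
  apply: eq_bigr => j _ /=.
  by case: eqP => _; case: (_ <= k)%N; rewrite ?mul1r ?mul0r.
by rewrite (sum_delta (fun j => if (#|seen m.+1 set0 i| <= k)%N then v j else 0)).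
Qed.

Lemma valid_junta_alg m : valid_alg N (junta_alg m).
Proof.
rewrite /valid_alg dim_junta_alg /=.
split; first by apply/ssrnat.leP; rewrite muln_gt0 !expn_gt0 muln_gt0 !expn_gt0.
split.
  by rewrite vnorm2E (sum_prodv_norm _ _ m.+1) vnorm_max_ent expr1n.
split.
  case=> [|j] _; first exact: unitary_idm.
  by rewrite expnS; apply/unitary_rot/unitary_bell.
split=> i j /ssrnat.ltP iM /ssrnat.ltP jM.
  rewrite /adj eq_sym; case: eqP => [->|_] /=; last exact: rmorph0.
  by case: ifP => _; [exact: rmorph1|exact: rmorph0].
transitivity (mvec (M ^ m.+1) (acc_proj (junta_alg m))
  (fun l => acc_proj (junta_alg m) l j) i); first by rewrite mvecE mmulE.
rewrite acc_projE//=.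
by case: (_ <= k)%N; rewrite ?andbF ?andbT.
Qed.

Lemma run_state_junta_alg m U t i : (t <= m.+1)%N -> (i < M ^ m.+1)%N ->
  run_state N (junta_alg m) U t i =
  prodv M (nseq (m.+1 - t) (max_ent n) ++ nseq t (pauli_amplitude n U)) i.
Proof.
elim: t i => [|t IH] i tm iM.
  rewrite [run_state _ _ _ _]/run_state dim_junta_alg mvec_idm// subn0.
  by rewrite cats0.
have -> : run_state N (junta_alg m) U t.+1 =
    mvec (M ^ m.+1) (rot_op M (M ^ m) (bell n))
      (mvec (M ^ m.+1) (tens_id N U) (run_state N (junta_alg m) U t)).
  by rewrite -dim_junta_alg.
set s := nseq (m - t) (max_ent n) ++ nseq t (pauli_amplitude n U).
have sE : size s = m by rewrite size_cat !size_nseq subnK.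
have -> : nseq (m.+1 - t.+1) (max_ent n) ++ nseq t.+1 (pauli_amplitude n U) =
    rcons s (pauli_amplitude n U).
  by rewrite subSS -cats1 -catA -[[:: _]]/(nseq 1 _) -nseqD addn1.
transitivity (mvec (M * M ^ m) (rot_op M (M ^ m) (bell n))
    (prodv M (mvec M (tens_id N U) (max_ent n) :: s)) i).
  rewrite -expnS; apply: mvec_ext => j jM.
  transitivity (mvec (N * (N * M ^ m)) (tens_id N U)
      (prodv M (max_ent n :: s)) j).
    rewrite dim_alg; apply: mvec_ext => l lM; rewrite IH//; last exact: ltnW.
    by rewrite subSn.
  by rewrite mvec_tens_prodv// dim_alg.
have := @mvec_rot_prodv M (bell n) (mvec M (tens_id N U) (max_ent n)) s i.
by rewrite sE -expnS; apply.
Qed.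

Lemma sum_seen v m S :
  \sum_(i < M ^ m) (if (#|seen m S i| <= k)%N
    then Cnorm2 (prodv M (nseq m v) i) else 0) =
  accept_from (fun y => Cnorm2 (v y)) m S.
Proof.
elim: m S => [|m IH] S.
  by rewrite expn0 big_ord1 Cnorm2_1 /=; case: ifP.
rewrite expnS (sum_nat_mul _ _ (fun i => if (#|seen m.+1 S i| <= k)%N
    then Cnorm2 (prodv M (nseq m.+1 v) i) else 0)).
rewrite exchange_big /=; apply: eq_bigr => y _.
rewrite -IH mulr_sumr; apply: eq_bigr => a _.
rewrite modn_pair// divn_pair// Cnorm2M.
by case: ifP; rewrite ?mulr0.
Qed.

Lemma accept_junta_alg m U : accept_prob N (junta_alg m) U =
  accept_from (fun y => Cnorm2 (pauli_amplitude n U y)) m.+1 set0.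
Proof.
rewrite /accept_prob dim_junta_alg [nq _]/= vnorm2E -sum_seen; apply: eq_bigr => i _.
rewrite acc_projE// run_state_junta_alg// subnn cat0s.
by case: ifP; rewrite // Cnorm2_0.
Qed.

Section Acceptance.
Variable p : nat -> R.

Lemma accept_complete m (S T : {set 'I_n}) :
  (forall y, (y < M)%N -> ~~ (pauli_supp n y \subset T) -> p y = 0) ->
  \sum_(y < M) p y = 1 -> (#|T| <= k)%N -> S \subset T ->
  accept_from p m S = 1.
Proof.
move=> pT p1 Tk; elim: m S => [|m IH] S ST /=.
  by rewrite (leq_trans (subset_leq_card ST)).
rewrite -[RHS]p1; apply: eq_bigr => y _.
have [yT|/(pT _ (ltn_ord y)) ->] := boolP (pauli_supp n y \subset T).
  by rewrite IH ?mulr1// subUset ST.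
by rewrite mul0r.
Qed.

(** Farness speaks of sets of exactly k qubits, whereas the set of seen qubits may still be
    smaller. *)
Lemma superset_of_card (S : {set 'I_n}) j : (#|S| <= j <= n)%N ->
  exists2 T : {set 'I_n}, S \subset T & #|T| = j.
Proof.
elim: j => [|j IH] /andP[Sj jn].
  by exists S => //; apply/eqP; rewrite -leqn0.
have [Sj'|jS] := leqP #|S| j; last first.
  by exists S => //; apply/eqP; rewrite eqn_leq Sj.
have [|T ST Tj] := IH; first by rewrite Sj' ltnW.
have [q qT] : exists q, q \notin T.
  have /subsetPn[q _ qT] : ~~ ([set: 'I_n] \subset T).
    by apply: contraL jn => /subset_leq_card; rewrite cardsT card_ord Tj -leqNgt.
  by exists q.
exists (q |: T); first exact: (subset_trans ST (subsetUr _ _)).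
by rewrite cardsU1 qT Tj.
Qed.

Hypotheses (p0 : forall y, 0 <= p y) (p1 : \sum_(y < M) p y = 1).
Variable delta : R.
Hypothesis kn : (k <= n)%N.
Hypothesis p_far : forall T : {set 'I_n}, #|T| = k ->
  \sum_(y < M | pauli_supp n y \subset T) p y <= 1 - delta.

(** Besides keeping 1 - delta/2 nonnegative, this shows with delta = eps^2 that a far unitary forces
    eps <= 1. *)
Lemma far_delta_le1 : delta <= 1.
Proof.
have [|T _ Tk] := @superset_of_card set0 k; first by rewrite cards0.
rewrite -subr_ge0; apply: le_trans (p_far Tk).
by apply: sumr_ge0 => y _.
Qed.

Lemma accept_over m (S : {set 'I_n}) : (k < #|S|)%N -> accept_from p m S = 0.
Proof.
elim: m S => [|m IH] S kS /=; first by rewrite leqNgt kS.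
apply: big1 => y _; rewrite IH ?mulr0//.
by apply: leq_trans kS _; apply/subset_leq_card/subsetUl.
Qed.

(* Potential argument: with probability at least [delta] a sample enlarges [S],
   which halves [2 ^ (k - #|S|)]. *)
Lemma accept_sound m (S : {set 'I_n}) : (#|S| <= k)%N ->
  accept_from p m S <= 2 ^+ (k - #|S|) * (1 - delta / 2) ^+ m.
Proof.
have d1 := far_delta_le1.
have rho0 : 0 <= 1 - delta / 2 by lra.
elim: m S => [|m IH] S Sk /=.
  by rewrite Sk mulr1 exprn_ege1// ler1n.
set A := 2 ^+ (k - #|S|) * (1 - delta / 2) ^+ m.
have A0 : 0 <= A by rewrite mulr_ge0// exprn_ge0.
have step y : accept_from p m (S :|: pauli_supp n y) <=
    if pauli_supp n y \subset S then A else A / 2.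
  case: ifP => yS; first by rewrite (setUidPl yS); exact: IH.
  have lt : (#|S| < #|S :|: pauli_supp n y|)%N.
    apply: proper_card; rewrite properE subsetUl /=.
    by apply/negP; rewrite subUset yS andbF.
  (* Beyond k qubits the truncated exponent would no longer halve the potential, but the acceptance
     probability is 0 there. *)
  have [kS|Sk'] := ltnP k #|S :|: pauli_supp n y|.
    by rewrite accept_over// divr_ge0.
  apply: le_trans (IH _ Sk') _; rewrite /A mulrAC ler_wpM2r ?exprn_ge0//.
  rewrite ler_pdivlMr// -exprSr ler_eXn2l ?ltr1n//.
  by lia.
apply: (@le_trans _ _ (\sum_(y < M) p y * (if pauli_supp n y \subset S then A else A / 2))).
  by apply: ler_sum => y _; rewrite ler_wpM2l.
(* Every outcome pays A/2, and those that do not enlarge [S] pay it twice; their weight is at most 1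
   - delta, for a total of A (1 - delta/2). *)
have -> : \sum_(y < M) p y * (if pauli_supp n y \subset S then A else A / 2) =
    A / 2 * (1 + \sum_(y < M | pauli_supp n y \subset S) p y).
  rewrite -[X in X + _]p1 [X in _ + X]big_mkcond -big_split mulr_sumr; apply: eq_bigr => y _ /=.
  by case: ifP => _; [rewrite -mulr2n -mulr_natr; field|rewrite addr0 mulrC].
have [|T ST Tk] := @superset_of_card S k; first by rewrite Sk kn.
have wS : \sum_(y < M | pauli_supp n y \subset S) p y <= 1 - delta.
  apply: le_trans (p_far Tk); rewrite big_mkcond [leRHS]big_mkcond /=.
  apply: ler_sum => y _; case: ifP => yS; first by rewrite (subset_trans yS ST).
  by case: ifP.
have -> : 2 ^+ (k - #|S|) * (1 - delta / 2) ^+ m.+1 = A / 2 * (2 - delta).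
  by rewrite exprSr /A; field.
by rewrite ler_wpM2l ?divr_ge0//; lra.
Qed.

End Acceptance.
End Algorithm.

(** * Juntas as sets of qubits *)

Section Junta.
Variable n : nat.
Local Notation N := (2 ^ n)%N.
Local Notation X := {ffun 'I_n -> bool}.

Definition qubits (T : {set 'I_n}) : seq nat := [seq val q | q <- enum T].

Lemma mem_qubits T (q : 'I_n) : (val q \in qubits T) = (q \in T).
Proof. by rewrite mem_map ?mem_enum//; exact: val_inj. Qed.

Lemma size_qubits T : size (qubits T) = #|T|.
Proof. by rewrite size_map -cardE. Qed.

Lemma qubits_lt T i : i \in qubits T -> (i < n)%N.
Proof. by case/mapP => q _ ->; exact: ltn_ord. Qed.

Lemma In_mem (s : seq nat) x : List.In x s <-> x \in s.
Proof.
elim: s => [//|y s IH] /=; rewrite inE; split.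
  by case=> [->|/IH ->]; rewrite ?eqxx ?orbT.
by case/orP => [/eqP ->|/IH]; [left|right].
Qed.

Lemma Sorted_sorted s : Sorted.Sorted lt s <-> sorted ltn s.
Proof.
elim: s => [|x s IH]; first by split=> // _; constructor.
split=> /= [h|xs].
  have [/IH sS hx] := Sorted.Sorted_inv h.
  case: s hx sS {IH h} => //= y s hx ->; rewrite andbT.
  by apply/ssrnat.ltP; exact: Sorted.HdRel_inv hx.
constructor; first by apply/IH/path_sorted/xs.
case: s xs {IH} => [|y s] /=; first by constructor.
by case/andP => /ssrnat.ltP xy _; constructor.
Qed.

Lemma sorted_qubits T : sorted ltn (qubits T).
Proof.
rewrite sorted_map /enum_mem; apply: sorted_filter.
  by move=> y x z; exact: ltn_trans.
by have := iota_ltn_sorted 0 n; rewrite -val_enum_ord sorted_map enumT.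
Qed.

Lemma valid_subsetP k L : valid_subset n k L <->
  exists2 T : {set 'I_n}, #|T| = k & L = qubits T.
Proof.
split=> [[/Sorted_sorted sL [sz /List.Forall_forall Ln]]|[T <- ->]]; last first.
  split; first exact/Sorted_sorted/sorted_qubits.
  split; first exact: size_qubits.
  by apply/List.Forall_forall => q /In_mem /qubits_lt /ssrnat.ltP.
pose T := [set q : 'I_n | val q \in L].
have LT : L = qubits T.
  apply: (irr_sorted_eq ltn_trans ltnn sL (sorted_qubits T)) => i.
  apply/idP/idP => [iL|iT].
    have iN : (i < n)%N by apply/ssrnat.ltP/Ln/In_mem.
    by have := mem_qubits T (Ordinal iN); rewrite inE iL => ->.
  have iN := qubits_lt iT.
  by have := mem_qubits T (Ordinal iN); rewrite inE iT.
by exists T; rewrite // -size_qubits -LT -sz.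
Qed.

Lemma agree_offE (T : {set 'I_n}) i j :
  agree_off n (qubits T) i j = agree (~: T) (bits n i) (bits n j).
Proof.
have existsE q : List.existsb (Nat.eqb q) (qubits T) = (q \in qubits T).
  apply/idP/idP => [/List.existsb_exists[r [/In_mem rT /Nat.eqb_eq -> //]]|qT].
  by apply/List.existsb_exists; exists q; split; [exact/In_mem|exact/Nat.eqb_eq].
apply/idP/forall_inP => [/List.forallb_forall h q|h].
  rewrite inE !ffunE => qT; have := h q.
  rewrite existsE mem_qubits (negbTE qT) => /(_ _) hq.
  apply/eqP/Bool.eqb_prop/hq/List.in_seq; split; [exact: Nat.le_0_l|].
  exact/ssrnat.ltP.
apply/List.forallb_forall => q /List.in_seq[_ /ssrnat.ltP qn].
rewrite existsE; case: ifP => // /negP qT.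
have := h (Ordinal qn); rewrite inE !ffunE => /(_ _)/eqP -> //.
  by case: (Nat.testbit j q).
by rewrite -mem_qubits; exact/negP.
Qed.

Lemma restr_testbit s i j : (j < size s)%N ->
  Nat.testbit (restr s i) j = Nat.testbit i (nth 0%N s j).
Proof.
elim: s j => [//|q s IH] j js.
have -> : restr (q :: s) i =
    Nat.add (Nat.mul 2 (restr s i)) (Nat.b2n (Nat.testbit i q)).
  exact: Nat.add_comm.
case: j js => [|j] js; first exact: Nat.testbit_0_r.
by rewrite Nat.testbit_succ_r IH.
Qed.

Lemma restr_lt s i : (restr s i < 2 ^ size s)%N.
Proof. by elim: s => [//|q s IH] /=; rewrite expnS; case: Nat.testbit; lia. Qed.

Definition restrict (T : {set 'I_n}) (x : X) : {ffun 'I_#|T| -> bool} :=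
  [ffun j => x (enum_val j)].

Lemma restrict_agree (T : {set 'I_n}) x y : (restrict T x == restrict T y) = agree T x y.
Proof.
apply/eqP/forall_inP => [/ffunP h q qT|h].
  by have := h (enum_rank_in qT q); rewrite !ffunE enum_rankK_in// => ->.
by apply/ffunP => j; rewrite !ffunE; apply/eqP/h/enum_valP.
Qed.

Lemma restrict_surj (T : {set 'I_n}) u : exists x, restrict T x = u.
Proof.
exists [ffun q => if (insub q : option {q | q \in T}) is Some z
  then u (enum_rank_in (valP z) (val z)) else false].
apply/ffunP => j; rewrite !ffunE.
case: insubP => [z _ zj|]; last by rewrite enum_valP.
by congr (u _); apply: enum_val_inj; rewrite enum_rankK_in ?zj// enum_valP.
Qed.

Lemma restrict_bits (T : {set 'I_n}) i : bits #|T| (restr (qubits T) i) = restrict T (bits n i).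
Proof.
apply/ffunP => j; rewrite !ffunE restr_testbit ?size_qubits//.
congr Nat.testbit; rewrite (nth_map (enum_val j)) -?cardE//.
by congr val; exact: esym (enum_val_nth _ _).
Qed.

(** Identifies [embed] with the matrix [E] of [near_junta], for f = [restrict T] and p = [off T]. *)
Lemma embedE (T : {set 'I_n}) V i j :
  embed n (qubits T) V i j =
  if off T (bits n i) == off T (bits n j)
  then on_bits V (restrict T (bits n i)) (restrict T (bits n j)) else 0.
Proof.
rewrite /embed agree_offE -off_agree; case: ifP => // _.
by rewrite /on_bits -!restrict_bits !bitsK// -size_qubits restr_lt.
Qed.

Lemma sum_amplitude U : unitary N U ->
  \sum_(y < N * N) Cnorm2 (pauli_amplitude n U y) = 1.
Proof.
move=> UU; have := pauli_weight U [set: 'I_n].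
under eq_bigl do rewrite subsetT.
under [X in _ = X / _]eq_bigl do rewrite subsetT.
under [X in _ = X / _]eq_bigr do under eq_bigl do rewrite subsetT.
move=> ->; rewrite fourier_total ?divff//; last exact: on_bits_isometry.
by rewrite expf_neq0// pnatr_eq0 -lt0n expn_gt0.
Qed.

Lemma junta_amplitude k U : has_property N (juntas n k) U ->
  exists2 T : {set 'I_n}, #|T| = k & forall y, (y < N * N)%N ->
    ~~ (pauli_supp n y \subset T) -> Cnorm2 (pauli_amplitude n U y) = 0.
Proof.
move=> [W [t [[L [V [/valid_subsetP[T Tk ->] [_ WV]]]] UW]]].
exists T => // y yM; have [a [b [aN bN ->]]] := pair_eta yM.
rewrite /pauli_supp modn_pair// divn_pair// pauli_amplitudeE// => abT.
(* The global phase is absorbed into the local matrix. *)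
pose G (u v : {ffun 'I_#|T| -> bool}) := Cexpi t * on_bits V u v.
suff -> : phi (on_bits U) (bits n a) (bits n b) = 0 by rewrite mulr0 Cnorm2_0.
rewrite -(phi_junta (@restrict_agree T) G abT); apply: eq_bigr => r _; congr (_ * _).
have lt (x : X) : (unbits x < N)%coq_nat by apply/ssrnat.ltP; exact: unbits_lt.
rewrite /on_bits UW// /mscale WV ?pow_expn// embedE !unbitsK /G.
by case: ifP => // _; exact: mulr0.
Qed.

Lemma far_weight k U eps (T : {set 'I_n}) : unitary N U -> 0 < eps ->
  eps_far N (juntas n k) U eps -> #|T| = k ->
  \sum_(y < N * N | pauli_supp n y \subset T) Cnorm2 (pauli_amplitude n U y)
    <= 1 - eps ^+ 2.
Proof.
move=> UU e0 Ufar Tk.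
have [V [VU]] := near_junta (on_bits_isometry UU)
  (restriction_bij (@restrict_agree T) (@restrict_surj T)).
have cX : #|{ffun 'I_n -> bool}| = N by rewrite card_ffun card_bool card_ord.
have cA : #|{ffun 'I_#|T| -> bool}| = (2 ^ #|T|)%N.
  by rewrite card_ffun card_bool card_ord.
rewrite /= cX cA -(fourier_weight (@restrict_agree T)).
rewrite pauli_weight; set w := \sum_(a | _) _; set d := \sum_x _ => wd.
pose V' : Mat := fun i j => V (bits #|T| i) (bits #|T| j).
have juntaE : juntas n k (embed n (qubits T) V').
  exists (qubits T), V'; split; first by apply/valid_subsetP; exists T.
  split=> // i j /ssrnat.ltP; rewrite pow_expn -Tk => iA /ssrnat.ltP jA.
  rewrite mmulE idmE.
  rewrite (sum_bits #|T| (fun l => adj V' i l * V' l j)).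
  have -> : (i == j) = (bits #|T| i == bits #|T| j).
    by apply/eqP/eqP => [->//|/bits_inj]; exact.
  by rewrite -VU; apply: eq_bigr => x _; rewrite /adj /V' unbitsK.
(* Farness is used at phase 0 only, since [near_junta] bounds the distance to this junta without any
   phase correction. *)
have /RleP : (eps <= / sqrt (2 * INR N) *
    fnorm N (msub (mscale (Cexpi 0) U) (embed n (qubits T) V')))%coqR.
  apply: Ufar => //; split; first exact: Rle_refl.
  exact: Rmult_lt_0_compat Rlt_0_2 PI_RGT_0.
have -> : fnorm N (msub (mscale (Cexpi 0) U) (embed n (qubits T) V')) = Num.sqrt d.
  rewrite /fnorm RsqrtE Rsum_big; congr Num.sqrt.
  rewrite (sum_bits n (fun i => Rsum N (fun j => Cnorm2 (msub _ _ i j)))).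
  apply: eq_bigr => x _; rewrite Rsum_big.
  rewrite (sum_bits n (fun j => Cnorm2 (msub _ _ (unbits x) j))).
  apply: eq_bigr => y _; congr Cnorm2; rewrite /msub /mscale embedE !unbitsK.
  rewrite /V' /on_bits !unbitsK.
  have -> : Cexpi 0 = 1 by rewrite /Cexpi cos_0 sin_0.
  by congr Csub; exact: mul1r.
have d0 : 0 <= d by apply: sumr_ge0 => x _; apply: sumr_ge0 => y _; exact: Cnorm2_ge0.
have N0 : 0 < (N%:R : R) by rewrite ltr0n expn_gt0.
rewrite RinvE RmultE RsqrtE RmultE INRE (_ : 2%coqR = 2%:R)//.
rewrite -sqrtrV ?mulr_ge0// -sqrtrM ?invr_ge0 ?mulr_ge0//.
move=> epsd.
have eps2 : eps ^+ 2 <= (2 * N%:R)^-1 * d.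
  rewrite -[leRHS]sqr_sqrtr ?mulr_ge0 ?invr_ge0 ?mulr_ge0//.
  by rewrite ler_pXn2r ?nnegrE ?sqrtr_ge0// ltW//; exact/RltP.
rewrite ler_pdivrMr ?exprn_gt0//.
have eN : eps ^+ 2 * N%:R ^+ 2 <= N%:R * d / 2.
  have -> : N%:R * d / 2 = (2 * N%:R)^-1 * d * N%:R ^+ 2 by field; rewrite gt_eqF.
  by rewrite ler_wpM2r ?sqr_ge0.
by move: wd eN; rewrite mulrBl mul1r; lra.
Qed.
End Junta.

Lemma junta_tester (n k : nat) (eps : R) : (1 <= k)%coq_nat /\ (k <= n)%coq_nat ->
  (0 < eps)%coqR -> exists A : algorithm,
    valid_alg (Nat.pow 2 n) A /\ eps_tests (Nat.pow 2 n) (juntas n k) eps A /\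
    (INR (nq A) <= 68 * Rmax 1 (INR k * ln (INR k / eps) / eps ^ 2))%coqR.
Proof.
rewrite pow_expn => -[/ssrnat.leP k0 /ssrnat.leP kn] /RltP e0.
have [m [mle merr]] := query_count k eps (elimT ssrnat.leP k0) (elimT RltP e0).
exists (junta_alg n k m); split; first exact: valid_junta_alg.
split=> // U UU; split=> [/junta_amplitude[T Tk pT]|Ufar]; apply/RleP;
  rewrite accept_junta_alg.
  rewrite (@accept_complete n k _ m.+1 set0 T)//; rewrite ?sub0set ?Tk//.
    by rewrite RdivE (_ : 2%coqR = 2%:R)// (_ : 3%coqR = 3%:R)//; lra.
  exact: sum_amplitude.
have p_far := far_weight UU e0 Ufar.
have p0 y := Cnorm2_ge0 (pauli_amplitude n U y).
have p1 := sum_amplitude UU.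
(* A far U exists only for eps <= 1, the range where [query_count] supplies the error bound. *)
have e1 : eps <= 1.
  have := far_delta_le1 p0 kn p_far.
  by rewrite -[leRHS](expr1n _ 2) ler_pXn2r ?nnegrE// ltW.
have := accept_sound p0 p1 kn p_far m.+1 (S := set0).
rewrite cards0 subn0 => /(_ isT) h; apply: (le_trans h).
have /RleP := merr (elimT RleP e1).
by rewrite RmultE !RpowE RminusE RdivE.
Qed.

End JuntaTester.

Theorem theorem2 :
  exists c : R, 0 < c /\
    forall (n k : nat) (eps : R),
      (1 <= n)%nat -> (1 <= k <= n)%nat -> 0 < eps ->
      exists A : algorithm,
        valid_alg (2 ^ n) A /\
        eps_tests (2 ^ n) (juntas n k) eps A /\
        INR (nq A) <= c * Rmax 1 (INR k * ln (INR k / eps) / eps ^ 2).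
Proof.
  exists 68; split; [lra|].
  intros n k eps _ Hk Heps.
  exact (JuntaTester.junta_tester Hk Heps).
Qed.
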